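(* Let $W$ be a finite-dimensional $\mathbb{Z}/2\mathbb{Z}$-graded vector space over $\mathbb{Q}$ with a symmetric nondegenerate odd bilinear form, let $V:=\Pi W$, and let $h\in\mathcal{MC}(\mathfrak{h}_{\geq 2}[V])$ be a cyclic $A_\infty$-structure on $W$. Write $\Lambda:=\Lambda_{\gamma,\nu}[V]$ with its filtration $F_p=F_p[\Lambda]$. Let $n\ge0$ and let $x_n=h_0+\cdots+h_n\in\mathcal{MC}(\Lambda/F_{n+1})$, with $h_i\in\Lambda$ homogeneous of order $i$ and $h_0=h$. Then the (even part of the) cohomology group $\mathcal{H}^{n+1}(A)$ acts freely and transitively on the set $\mathrm{Ext}(x_n)$ of equivalence classes of extensions of $x_n$, by $$\mathcal{H}^{n+1}(A)\times\mathrm{Ext}(x_n)\to\mathrm{Ext}(x_n),\qquad(\alpha_{n+1},h_{n+1})\mapsto\alpha_{n+1}+h_{n+1}.$$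
   Context: Conventions. All spaces are over $\mathbb{Q}$, $\mathbb{Z}/2\mathbb{Z}$-graded; $\Pi$ is parity reversion; $|a|$ is parity. A differential graded Lie algebra (dgla) has an odd bracket, meaning that $\Pi\mathfrak g$ is an ordinary dgla: explicitly $[a,b]=(-1)^{|a||b|}[b,a]$, $[[a,b],c]+(-1)^{|b||c|}[[a,c],b]+(-1)^{|a|(|b|+|c|)}[[b,c],a]=0$, $d$ odd, $d^2=0$, $d[a,b]=-[da,b]-(-1)^{|a|}[a,db]$. $\mathcal{MC}(\mathfrak g)=\{x\in\mathfrak g_0: dx+\frac12[x,x]=0\}$. For $y$ odd, $\exp(y)\cdot x:=x+\sum_{k\ge0}\frac1{(k+1)!}(\mathrm{ad}\,y)^k(dy+[y,x])$, whenever the sum converges. The Lie bialgebra $\mathfrak h[V]$. The form on $W$ makes $V=\Pi W$ a space with a nondegenerate skew-symmetric odd bilinear form $\langle-,-\rangle$. The dual odd form $\langle-,-\rangle^{-1}$ on $V^*$ is: for a basis $x_i$ (even), $\xi_i$ (odd) of $V$ with $\langle x_i,\xi_j\rangle=\delta_{ij}$, $\langle x_i^*,\xi_j^*\rangle^{-1}=\langle\xi_j^*,x_i^*\rangle^{-1}=\delta_{ij}$, other values zero. Put $\mathfrak h=\mathfrak h[V]:=\prod_{n\ge0}[(V^* )^{\otimes n}]_{\mathbb Z/n\mathbb Z}$ (cyclic words, Koszul signs), and $\mathfrak h_{\ge i}$ the part of words of length $\ge i$. Bracket: $$\{a_1\cdots a_n,b_1\cdots b_m\}=\sum_{i,j}\pm\langle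 a_i,b_j\rangle^{-1}\,a_{i+1}\cdots a_na_1\cdots a_{i-1}\,b_{j+1}\cdots b_mb_1\cdots b_{j-1},$$ $\pm$ being the Koszul sign of the permutation of letters taking $a_1\cdots a_nb_1\cdots b_m$ to $a_ib_ja_{i+1}\cdots a_{i-1}b_{j+1}\cdots b_{j-1}$. Cobracket: $$\Delta(a_1\cdots a_n)=\tfrac12\sum_{i<j}(-1)^p\langle a_i,a_j\rangle^{-1}[1+(1\,2)]\cdot[(a_{i+1}\cdots a_{j-1})\otimes(a_{j+1}\cdots a_na_1\cdots a_{i-1})],$$ $p=|a_i|(|a_1|+\dots+|a_i|)+|a_j|(|a_1|+\dots+|a_j|)+(|a_1|+\dots+|a_{i-1}|)(|a_{i+1}|+\dots+|a_{j-1}|+|a_{j+1}|+\dots+|a_n|)$. These make $\mathfrak h$ an involutive Lie bialgebra, and $\mathfrak h_{\ge2}$ is a Lie subalgebra. The dgla $\Lambda_{\gamma,\nu}[V]$. On $\widehat S(\mathfrak h)=\prod_n(\mathfrak h^{\hat\otimes n})_{S_n}$ let $\delta(g_1\cdots g_n)=\sum_{i<j}\pm\{g_i,g_j\}g_1\cdots\hat g_i\cdots\hat g_j\cdots g_n$ (Koszul sign for moving $g_i,g_j$ to the front), extend $\Delta$ as a derivation, and extend the bracket by the Leibniz rule: $[x,y]=\delta(xy)-\delta(x)y-(-1)^{|x|}x\delta(y)$. Then $\mathfrak l:=\widehat S(\mathfrak h)\hat\otimes\mathbb Q[[\gamma]]$ ($\gamma$ an even parameter) with $d:=\gamma\delta+\Delta$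 is a dgla. Since $\mathfrak h=\mathfrak h_{\ge1}\times\mathbb Q$, writing $\nu$ for the empty word gives $\mathfrak l=\widehat S(\mathfrak h_{\ge1})\hat\otimes\mathbb Q[[\gamma,\nu]]$. The summand $\mathbb Q[[\gamma,\nu]]$ is a dg ideal; the quotient is identified with $\mathfrak l'=\widehat S^{\ge1}(\mathfrak h_{\ge1})\hat\otimes\mathbb Q[[\gamma,\nu]]$. Finally $\Lambda_{\gamma,\nu}[V]\subset\mathfrak l'$ is the sub-dgla of elements whose component on a single cyclic word of length 1 with no factor of $\gamma$ or $\nu$ is zero. Filtration. A tensor $\gamma^g\nu^m h_1\cdots h_k$ ($h_i\in\mathfrak h_{\ge1}$) has order $2g+m+k-1$; $F_p[\Lambda_{\gamma,\nu}]$ consists of all tensors of order $\ge p$. Each $F_p$ is a dg ideal, $[F_p,F_q]\subset F_{p+q}$, $d(F_p)\subset F_{p+1}$, and $\Lambda_{\gamma,\nu}/F_1=\mathfrak h_{\ge2}$ (with zero differential); $\mathfrak h_{\ge2}$ is also embedded in $\Lambda_{\gamma,\nu}$ as the order-zero part, which is a Lie subalgebra. Cyclic $A_\infty$-structure and $\mathcal H^\bullet(A)$. A cyclic $A_\infty$-structure on $W$ is $h\in\mathcal{MC}(\mathfrak h_{\ge2}[V])$, i.e. $h$ even with $\{h,h\}=0$; the corresponding cyclic $A_\infty$-algebra is $A=(W,\langle-,-\rangle,h)$. Then $\mathrm{ad}\,h=[h,-]$ is a differential on $\Lambda_{\gamma,\nu}$ preserving order. $\mathcal H^\bullet(A)$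 is the cohomology of $(\Lambda_{\gamma,\nu},\mathrm{ad}\,h)$, and $\mathcal H^{n}(A)$ is its part of order $n$. Extensions. An extension of $x_n$ is an (even) element $h_{n+1}\in\Lambda_{\gamma,\nu}$ homogeneous of order $n+1$ such that $x_n+h_{n+1}\in\mathcal{MC}(\Lambda_{\gamma,\nu}/F_{n+2})$. Two extensions $h_{n+1},h'_{n+1}$ are equivalent if there is an (odd) element $\xi_{n+1}\in\Lambda_{\gamma,\nu}$ of order $n+1$ with $\exp(\xi_{n+1})\cdot(x_n+h_{n+1})=x_n+h'_{n+1}\mod F_{n+2}$. $\mathrm{Ext}(x_n)$ is the set of equivalence classes of extensions (possibly empty). *)

(* Defs.v *)
From HB Require Import structures.
From mathcomp Require Import all_boot all_order all_algebra.
From mathcomp Require Import ring lra.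
From mathcomp Require Import mathcomp_extra boolp classical_sets functions.

Set Implicit Arguments.
Unset Strict Implicit.
Unset Printing Implicit Defensive.

Import Order.TTheory GRing.Theory Num.Theory.
Local Open Scope ring_scope.

(* An odd space presents V^* by a homogeneous basis: its letters are the basis *)
(* covectors, par is their parity and pair is the form <-,->^{-1} on letters.  *)
Record odd_space := OddSpace {
  letter :> finType;
  par : letter -> bool;
  pair : letter -> letter -> rat }.

Section FromForm.

Variables (W : vectType rat) (W0 W1 : {vspace W}) (form : {symmetric W}).

Definition is_graded := (W0 + W1)%VS = fullv /\ (W0 :&: W1)%VS = 0%VS.

Definition odd_form :=
  (forall u v, u \in W0 -> v \in W0 -> form u v = 0) /\
  (forall u v, u \in W1 -> v \in W1 -> form u v = 0).

Let dimW := (\dim W0 + \dim W1)%N.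

Definition basisW (k : 'I_dimW) : W := nth 0 (vbasis W0 ++ vbasis W1) k.

Definition parW (k : 'I_dimW) : bool := (\dim W0 <= k)%N.

Definition parV (k : 'I_dimW) : bool := ~~ parW k.

(* The form <Pi u, Pi v> = (-1)^|u| <u, v> on V = Pi W; it is odd, and it is   *)
(* skew-symmetric because the form on W is odd and symmetric.                  *)
Definition gramV : 'M[rat]_dimW :=
  \matrix_(k, l) ((-1) ^+ parW k * form (basisW k) (basisW l)).

(* If gramV = [[0, G], [- G^T, 0]] in the order (even, odd), then              *)
(* <x_i^*, xi_j^*>^{-1} = <xi_j^*, x_i^*>^{-1} = (G^{-1})_{ji}, which for      *)
(* G = 1 is delta_ij; the sign turns the skew gramV^{-1} into this form.       *)
Definition dual_form (k l : 'I_dimW) : rat :=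
  (-1) ^+ parV l * invmx gramV k l.

Definition PiDual : odd_space := OddSpace parV dual_form.

End FromForm.

(* The Koszul sign of the rearrangement x_0 x_1 ... -> x_(s_0) x_(s_1) ... of  *)
(* objects of parities p_0, p_1, ...                                           *)
Definition koszul (p : seq bool) (s : seq nat) : rat :=
  (-1) ^+ (\sum_(v < size s) \sum_(u < v)
    [&& nth 0 s v < nth 0 s u, nth false p (nth 0 s u)
      & nth false p (nth 0 s v)])%N.

(* cut i [:: a_0; ...; a_(n-1)] = a_(i+1) ... a_(n-1) a_0 ... a_(i-1) *)
Definition cut (T : Type) (i : nat) (w : seq T) : seq T := behead (rot i w).

Definition others (i j k : nat) : seq nat :=
  [seq l <- iota 0 k | (l != i) && (l != j)].

Section Lambda.

Variable S : odd_space.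

Definition word := seq S.

Definition wpar (w : word) : bool := odd (count (@par S) w).

(* A product w_1 ... w_k of words, the empty word standing for nu. *)
Definition tensor := seq word.

Definition tpar (s : tensor) : bool := odd (count wpar s).

Definition letters (s : tensor) : nat := size (flatten s).

(* Below, a finite linear combination sum_r c_r t_r is written as the          *)
(* functional phi |-> sum_r c_r phi(t_r).                                      *)

Definition word_bracket (a b : word) (phi : word -> rat) : rat :=
  \sum_(i < size a) \sum_(j < size b)
    koszul (map (@par S) (a ++ b))
      (nat_of_ord i :: (size a + j)%N ::
         cut i (iota 0 (size a)) ++ cut j (iota (size a) (size b)))
    * pair (tnth (in_tuple a) i) (tnth (in_tuple b) j)
    * phi (cut i a ++ cut j b).

Definition cobracket_sign (a : word) (i j : nat) : rat :=
  let P m n := wpar (drop m (take n a)) in (* letters m, ..., n - 1 *)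
  (-1) ^+ ((P i i.+1 * P 0 i.+1 + P j j.+1 * P 0 j.+1
           + P 0 i * (P i.+1 j + P j.+1 (size a)))%N).

Definition word_cobracket (a : word) (phi : word -> word -> rat) : rat :=
  2^-1 * \sum_(j < size a) \sum_(i < size a | (i < j)%N)
    let u := drop i.+1 (take j a) in
    let v := drop j.+1 a ++ take i a in
    cobracket_sign a i j * pair (tnth (in_tuple a) i) (tnth (in_tuple a) j)
    * (phi u v + (-1) ^+ (wpar u && wpar v) * phi v u).

Definition tensor_delta (s : tensor) (phi : tensor -> rat) : rat :=
  \sum_(j < size s) \sum_(i < size s | (i < j)%N)
    koszul (map wpar s) (nat_of_ord i :: nat_of_ord j :: others i j (size s))
    * word_bracket (nth [::] s i) (nth [::] s j)
        (fun w => phi (w :: [seq nth [::] s l | l <- others i j (size s)])).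

Definition tensor_Delta (s : tensor) (phi : tensor -> rat) : rat :=
  \sum_(i < size s) (-1) ^+ tpar (take i s)
    * word_cobracket (nth [::] s i)
        (fun u v => phi (take i s ++ [:: u; v] ++ drop i.+1 s)).

(* Elements of prod_n (V^* )^{(x) n}, by their coefficients on words; elements *)
(* of h are classes of these for the relation hzero.                           *)
Definition wser := word -> rat^o.

(* The generator of Z/n maps a_1 ... a_n to (-1)^{|a_1|(|a_2|+...+|a_n|)}      *)
(* a_2 ... a_n a_1; rot_sign is the sign.                                      *)
Definition rot_sign (w : word) : rat :=
  (-1) ^+ (wpar (take 1 w) && wpar (drop 1 w)).

Definition rotw (A : wser) : wser :=
  fun w => rot_sign (rotr 1 w) * A (rotr 1 w).

Definition hzero (f : wser) : Prop := exists A : wser, f = A - rotw A.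

(* The sum is over all pairs of words that can contribute to the coefficient   *)
(* at c: those have size c + 2 letters in total.                               *)
Definition hbracket (f g : wser) : wser := fun c =>
  \sum_(a : (size c).+2.-bseq S) \sum_(b : (size c).+2.-bseq S)
    f a * g b * word_bracket a b (fun c' => (c' == c)%:R).

Definition MC_h2 (f : wser) : Prop :=
  [/\ forall w, f w != 0 -> (2 <= size w)%N,
      forall w, f w != 0 -> wpar w = false
    & hzero (hbracket f f)].

(* Formal sums of tensors gamma^g w_1 ... w_k, by their coefficients: before   *)
(* passing to coinvariants, the elements of l. All elements of l and Lambda    *)
(* are handled through such representatives, equality being the relation       *)
(* lzero, resp. zero, on differences.                                          *)
Definition ser := nat -> tensor -> rat^o.

Definition mul (F G : ser) : ser := fun g s =>
  \sum_(g' < g.+1) \sum_(k < (size s).+1)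
    F g' (take k s) * G (g - g')%N (drop k s).

(* As above, the sums run over a finite set of tensors containing all those    *)
(* which contribute to the coefficient at t: these have letters t + 2 letters  *)
(* and one word more, resp. less, than t.                                      *)
Definition delta (F : ser) : ser := fun g t =>
  \sum_(s : (size t).+1.-tuple ((letters t).+2.-bseq S))
    F g (map val s) * tensor_delta (map val s) (fun t' => (t' == t)%:R).

Definition Delta (F : ser) : ser := fun g t =>
  \sum_(s : (size t).-1.-tuple ((letters t).+2.-bseq S))
    F g (map val s) * tensor_Delta (map val s) (fun t' => (t' == t)%:R).

Definition gamma_mul (F : ser) : ser :=
  fun g s => if g is g'.+1 then F g' s else 0.

Definition sgn (F : ser) : ser := fun g s => (-1) ^+ tpar s * F g s.

Definition diff (F : ser) : ser := gamma_mul (delta F) + Delta F.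

Definition bracket (F G : ser) : ser :=
  delta (mul F G) - mul (delta F) G - mul (sgn F) (delta G).

(* The generators of the groups Z/n_1, ..., Z/n_k and S_k acting on products   *)
(* of k words: rotation of the i-th word, and exchange of the i-th and         *)
(* (i+1)-st words, both with Koszul signs.                                     *)
Definition rots (i : nat) (A : ser) : ser := fun g s =>
  let s' := set_nth [::] s i (rotr 1 (nth [::] s i)) in
  rot_sign (nth [::] s' i) * A g s'.

Definition swaps (i : nat) (A : ser) : ser := fun g s =>
  let u := nth [::] s i in
  let v := nth [::] s i.+1 in
  (-1) ^+ (wpar u && wpar v) * A g (take i s ++ [:: v; u] ++ drop i.+2 s).

(* F vanishes in l, that is, after passing to coinvariants. *)
Definition lzero (F : ser) : Prop :=
  exists A B : nat -> ser, forall g s,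
    F g s = \sum_(i < size s) (A i - rots i (A i)) g s
          + \sum_(i < (size s).-1) (B i - swaps i (B i)) g s.

(* F lies in the summand Q[[gamma, nu]]. *)
Definition vacuum (F : ser) : Prop :=
  forall g s, F g s != 0 -> all (@nilp _) s.

(* F vanishes in l' = l / Q[[gamma, nu]]. *)
Definition zero (F : ser) : Prop :=
  exists2 F0 : ser, vacuum F0 & lzero (F - F0).

Definition in_Lambda (F : ser) : Prop := forall a : S, F 0%N [:: [:: a]] = 0.

Definition embed (f : wser) : ser := fun g s =>
  if (g, s) is (0%N, [:: w]) then f w else 0.

(* If s consists of m empty and k nonempty words, gamma^g s has order          *)
(* 2g + m + k - 1.                                                             *)
Definition order (g : nat) (s : tensor) : nat := (2 * g + size s).-1.

(* homog and has_parity are conditions on the representative; a class of order *)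
(* p, resp. of parity b, is one that has such a representative.                *)
Definition homog (p : nat) (F : ser) : Prop :=
  forall g s, F g s != 0 -> order g s = p.

Definition has_parity (b : bool) (F : ser) : Prop :=
  forall g s, F g s != 0 -> tpar s = b.

Definition Fil (p : nat) (F : ser) : Prop :=
  exists2 F' : ser, zero (F - F') & forall g s, F' g s != 0 -> (p <= order g s)%N.

(* The class of x is in MC(Lambda / F_p). *)
Definition MC_mod (p : nat) (x : ser) : Prop :=
  (exists2 x0, has_parity false x0 & Fil p (x - x0)) /\
  Fil p (diff x + 2^-1 *: bracket x x).

(* exp(y).x converges to z for the filtration F. *)
Definition exp_cvg (y x z : ser) : Prop :=
  forall p, exists N0, forall N, (N0 <= N)%N ->
    Fil p (z - (x + \sum_(k < N) (k.+1`!%:R)^-1 *: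
                      iter k (bracket y) (diff y + bracket y x))).

Lemma deltaB F G : delta (F - G) = delta F - delta G.
Proof.
apply/funext => g; apply/funext => t; rewrite /delta !fctE -sumrB.
by apply: eq_bigr => s _; rewrite mulrBl.
Qed.

Lemma mulBr F G H : mul F (G - H) = mul F G - mul F H.
Proof.
apply/funext => g; apply/funext => t; rewrite /mul !fctE -sumrB.
apply: eq_bigr => i _; rewrite -sumrB.
by apply: eq_bigr => k _; rewrite mulrBr.
Qed.

Lemma bracketBr F G H : bracket F (G - H) = bracket F G - bracket F H.
Proof.
rewrite /bracket mulBr !deltaB !mulBr.
set a := delta _; set b := delta _; set c := mul _ _; set d := mul _ _.
by rewrite !opprB !addrA; apply/funext => g; apply/funext => s; rewrite !fctE; ring.
Qed.

Lemma bracket0r F : bracket F 0 = 0.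
Proof. by have := bracketBr F 0 0; rewrite !subrr. Qed.

Lemma zeroB F G : zero F -> zero G -> zero (F - G).
Proof.
move=> [F0 vF [A [B FE]]] [G0 vG [A' [B' GE]]]; exists (F0 - G0).
  move=> g s; rewrite !fctE => FG0; have [F00|/vF//] := eqVneq (F0 g s) 0.
  by apply: (vG g); apply: contraNneq FG0 => G00; rewrite F00 G00 subrr.
exists (A - A'), (B - B') => g s.
have -> : (F - G - (F0 - G0)) g s = (F - F0) g s - (G - G0) g s.
  by rewrite !fctE; ring.
rewrite FE GE opprD addrACA -!sumrB; congr (_ + _); apply: eq_bigr => i _.
  by rewrite /rots !fctE; ring.
by rewrite /swaps !fctE; ring.
Qed.

Lemma zero0 : zero 0.
Proof.
have z0 g s : (0 : ser) g s = 0 by [].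
exists 0; first by move=> g s; rewrite z0 eqxx.
exists (fun=> 0), (fun=> 0) => g s.
rewrite subr0 z0 !big1 ?addr0 // => i _.
  by rewrite -[LHS]/(0 - swaps i 0 g s) /swaps mulr0 subr0.
by rewrite -[LHS]/(0 - rots i 0 g s) /rots mulr0 subr0.
Qed.

Lemma neq0B (F G : ser) g s :
  (F - G) g s != 0 -> F g s != 0 \/ G g s != 0.
Proof.
have [F0 FG|] := eqVneq (F g s) 0; last by left.
by right; apply: contraNneq FG => G0; rewrite !fctE F0 G0 subrr.
Qed.

Section Cohomology.

Variables (f : wser) (n : nat) (b : bool).

(* Cocycles, and below coboundaries, of parity b and order n in the complex    *)
(* (Lambda, ad f).                                                             *)
Definition is_cocycle : {pred ser} := fun F =>
  `[< [/\ in_Lambda F, homog n F, has_parity b F & zero (bracket (embed f) F)] >].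

Lemma is_cocycle_zmod : zmod_closed is_cocycle.
Proof.
split=> [|F G].
  apply/asboolP; split=> [a|g s|g s|]; rewrite ?eqxx //.
  by rewrite bracket0r; exact: zero0.
move=> /asboolP[LF hF pF cF] /asboolP[LG hG pG cG].
apply/asboolP; split=> [a|g s /neq0B[/hF|/hG]//|g s /neq0B[/pF|/pG]//|].
  by rewrite !fctE LF LG subrr.
by rewrite bracketBr; exact: zeroB.
Qed.

HB.instance Definition _ := GRing.isZmodClosed.Build ser is_cocycle
  is_cocycle_zmod.

Record cocycle := Cocycle { cocycle_val :> ser; _ : cocycle_val \in is_cocycle }.
HB.instance Definition _ := [isSub for cocycle_val].
HB.instance Definition _ := [Choice of cocycle by <:].
HB.instance Definition _ := [SubChoice_isSubZmodule of cocycle by <:].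

Definition is_coboundary : {pred cocycle} := fun F =>
  `[< exists xi : ser, [/\ in_Lambda xi, homog n xi, has_parity (~~ b) xi
                         & zero (\val F - bracket (embed f) xi)] >].

Lemma is_coboundary_zmod : zmod_closed is_coboundary.
Proof.
split=> [|F G].
  apply/asboolP; exists 0; split=> [a|g s|g s|]; rewrite ?eqxx //.
  by rewrite raddf0 bracket0r subrr; exact: zero0.
move=> /asboolP[xi [Lx hx px cx]] /asboolP[et [Le he pe ce]].
apply/asboolP; exists (xi - et).
split=> [a|g s /neq0B[/hx|/he]//|g s /neq0B[/px|/pe]//|].
  by rewrite !fctE Lx Le subrr.
by rewrite raddfB bracketBr opprD addrACA -opprD; exact: zeroB.
Qed.

HB.instance Definition _ := GRing.isZmodClosed.Build cocycle is_coboundary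
  is_coboundary_zmod.

Definition cohomology : zmodType := {ideal_quot is_coboundary}.

Definition cohomology_class (F : cocycle) : cohomology :=
  \pi_({ideal_quot is_coboundary})%qT F.

End Cohomology.

Section Extensions.

Variables (x : ser) (n : nat).

Definition is_extension (e : ser) : Prop :=
  [/\ in_Lambda e, homog n.+1 e, has_parity false e & MC_mod n.+2 (x + e)].

Definition equiv_extension (e e' : ser) : Prop :=
  exists xi : ser, [/\ in_Lambda xi, homog n.+1 xi, has_parity true xi
    & exists2 z, exp_cvg xi (x + e) z & Fil n.+2 (z - (x + e'))].

Definition extension_class (e : ser) : set ser :=
  [set e' | is_extension e' /\ equiv_extension e e'].

Definition Ext : set (set ser) :=
  [set extension_class e | e in is_extension].

End Extensions.

End Lambda.

Section Actions.

Variables (G : zmodType) (X : Type) (act : G -> X -> X).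

Definition is_action : Prop :=
  (forall x, act 0 x = x) /\ (forall g g' x, act (g + g') x = act g (act g' x)).

Definition acts_freely : Prop := forall g x, act g x = x -> g = 0.

Definition acts_transitively : Prop := forall x y, exists g, act g x = y.

End Actions.

(* Main.v *)
Require Import Defs.
From HB Require Import structures.
From mathcomp Require Import all_boot all_order all_algebra.
From mathcomp Require Import zify ring lra.
From mathcomp Require Import mathcomp_extra boolp classical_sets functions.

Set Implicit Arguments.
Unset Strict Implicit.
Unset Printing Implicit Defensive.

Import Order.TTheory GRing.Theory Num.Theory.
Local Open Scope ring_scope.

(** The MC equation and the gauge action are linear modulo F_(n+2) in a        *)
(** perturbation a of order n+1: the curvature of x + a is that of x plus      *)
(** [h, a], and exp(xi).(x + e) = x + e + [xi, h], because the differential    *)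
(** raises the order and the bracket is additive on it. So the extensions form *)
(** a torsor under the cocycles of order n+1, and two of them are equivalent   *)
(** exactly when they differ by a coboundary. Since elements are handled       *)
(** through representatives, the symmetry [h, a] = [a, h] that this uses holds *)
(** only modulo rotations of words and exchanges of words; it is the one step  *)
(** where the form and the Koszul signs enter. *)

(** Write $x_n=h+y$ with $y$ of order at least 1, and let $a$ be even of order $n+1$. The
    differential raises the order by one and the bracket adds orders, so in the curvature
    $dz+\frac12[z,z]$ the terms $da$, $[y,a]$ and $[a,a]$ all fall into $F_{n+2}$, and adding $a$
    changes the curvature by $[h,a]$ only ([curvature_shift]). Being homogeneous of order $n+1$,
    $[h,a]$ lies in $F_{n+2}$ only if it vanishes ([Fil_homog]). Hence an extension plus $a$ is
    again an extension exactly when $a$ is a cocycle ([curvature_extension]); this gives the action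
    and its transitivity.

    The same count applies to $\exp(\xi)$ with $\xi$ of order $n+1$: the series converges because
    each $\mathrm{ad}\,\xi$ raises the order ([gauge_limit]), and modulo $F_{n+2}$ it only adds
    $[h,\xi]$ ([gauge_limit_mod]). So equivalence of extensions is cohomology of their difference
    ([equiv_extensionP]), which makes the action well defined and free.

    Both expansions also produce brackets with $h$ on the right, whereas cohomology is defined by
    $[h,-]$. [bracket_embedC] identifies the two in coinvariants: where $h$ is bracketed with
    another word, the results agree up to rotation ([word_bracketC]); where $h$ is only multiplied,
    they differ by an exchange of words. The rotation argument uses that the dual form is symmetric
    and odd ([PiDual_pairC], [PiDual_pair_odd]). *)

(* The libraries imported after Defs define constants with these names. *)
Local Notation mul := Defs.mul.
Local Notation zero := Defs.zero.
Local Notation order := Defs.order.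

(** * Koszul signs *)

Section Koszul.

Implicit Types (p : nat -> bool) (s : seq nat).

(** Recursive form of the exponent in [koszul]; parities are a function, so that indices can be
    shifted. *)
Fixpoint inversions p s : nat :=
  if s is x :: s' then
    (count (fun y => [&& (y < x)%N, p x & p y]) s' + inversions p s')%N
  else 0%N.

Lemma koszulE (p : seq bool) s :
  koszul p s = (-1) ^+ inversions (nth false p) s.
Proof.
rewrite /koszul; congr (_ ^+ _); elim: s => [|x s IHs] /=.
  by rewrite big_ord0.
rewrite big_ord_recl big_ord0 add0n; under eq_bigr do rewrite big_ord_recl.
rewrite big_split /=; congr (_ + _)%N; last by rewrite -IHs.
rewrite -sum1_count (big_nth 0%N) big_mkord [RHS]big_mkcond.
by apply: eq_bigr => i _; case: ifP.
Qed.

Lemma eq_inversions p q s : p =1 q -> inversions p s = inversions q s.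
Proof.
move=> eq_pq; elim: s => //= x s ->; congr (_ + _)%N.
by apply: eq_count => y; rewrite !eq_pq.
Qed.

(** Only pairs of odd objects contribute, so even objects can be deleted. *)
Lemma inversions_filter p s : inversions p s = inversions p (filter p s).
Proof.
elim: s => //= x s IHs; case px: (p x) => /=; last first.
  by rewrite IHs (eq_count (a2 := pred0)) ?count_pred0 // => y; rewrite andbF.
rewrite IHs count_filter; congr (_ + _)%N.
by apply: eq_count => y /=; rewrite ?px; case: (p y) (y < x)%N => [] [].
Qed.

Lemma inversions_succ p s :
  inversions p (map S s) = inversions (fun k => p k.+1) s.
Proof. by elim: s => //= x s ->; rewrite count_map. Qed.

Lemma inversions_cat p s t :
  inversions p (s ++ t) =
  (inversions p s + inversions p t
   + \sum_(x <- s) count (fun y => [&& (y < x)%N, p x & p y]) t)%N.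
Proof.
elim: s => [|x s IHs] /=; first by rewrite big_nil addn0.
by rewrite IHs count_cat big_cons; lia.
Qed.

Lemma inversions_iota p m n : inversions p (iota m n) = 0%N.
Proof.
elim: n m => //= n IHn m; rewrite IHn addn0.
apply/eqP; rewrite -leqn0 leqNgt -has_count; apply/hasPn => y.
by rewrite mem_iota; case: (ltnP y m) => //=; lia.
Qed.

Lemma inversions_cat_lt p s t : {in s & t, forall x y, (x < y)%N} ->
  inversions p (s ++ t) = (inversions p s + inversions p t)%N.
Proof.
move=> lt_st; rewrite inversions_cat big_seq big1 ?addn0 // => x sx.
apply/eqP; rewrite -leqn0 leqNgt -has_count; apply/hasPn => y ty.
by rewrite ltnNge (ltnW (lt_st _ _ sx ty)).
Qed.

Lemma inversions_cat_gt p s t : {in s & t, forall x y, (y < x)%N} ->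
  inversions p (s ++ t) =
  (inversions p s + inversions p t + count p s * count p t)%N.
Proof.
move=> gt_st; rewrite inversions_cat; congr (_ + _)%N.
elim: s gt_st => [|x s IHs] gt_st; first by rewrite big_nil.
rewrite big_cons /= IHs => [|y z sy tz]; last by rewrite gt_st // inE sy orbT.
rewrite mulnDl; congr (_ + _)%N; case px: (p x); last first.
  by rewrite (eq_count (a2 := pred0)) ?count_pred0 // => y /=; rewrite andbF.
by rewrite mul1n; apply: eq_in_count => y ty; rewrite gt_st ?mem_head.
Qed.

Lemma count_nth_iota (T : Type) (f : T -> bool) (w : seq T) m n :
  (m + n <= size w)%N ->
  count (nth false (map f w)) (iota m n) = count f (take n (drop m w)).
Proof.
move=> mn; have := @count_map _ _ f id (take n (drop m w)).
rewrite (eq_count (a1 := preim f id) (a2 := f)) // => <-.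
rewrite map_take map_drop -(map_nth_iota false) ?size_map ?count_map; last by lia.
by apply: eq_count.
Qed.

Lemma others0 j n : others 0 j.+1 n.+1 = [seq l.+1 | l <- iota 0 n & l != j].
Proof.
by rewrite /others /= (iotaDl 1 0) filter_map.
Qed.

Lemma othersS i j n : others i.+1 j.+1 n.+1 = 0%N :: map S (others i j n).
Proof. by rewrite /others /= (iotaDl 1 0) filter_map. Qed.

Lemma others_last j n : (j < n)%N ->
  others j n n.+1 = [seq l <- iota 0 n | l != j].
Proof.
move=> jn; rewrite /others -addn1 iotaD filter_cat /= eqxx andbF cats0.
apply: eq_in_filter => l; rewrite mem_iota => l_n.
by rewrite [l != n]neq_ltn; case: (l != j); rewrite //=; lia.
Qed.

Lemma others_rcons i j n : (i < n)%N -> (j < n)%N ->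
  others i j n.+1 = rcons (others i j n) n.
Proof.
move=> i_n j_n; rewrite /others -addn1 iotaD filter_cat /= add0n.
by rewrite !neq_ltn i_n j_n !orbT /= cats1.
Qed.

(** An even object can be moved without sign. This lemma and the next two treat the places that an
    even word takes when it multiplies a tensor on the left or on the right. *)
Lemma koszul_even_cons (p : seq bool) s :
  koszul (false :: p) (0%N :: map S s) = koszul p s.
Proof.
rewrite !koszulE; congr (_ ^+ _); rewrite inversions_filter /=.
by rewrite -inversions_filter inversions_succ.
Qed.

Lemma koszul_even_mid (p : seq bool) x y s :
  koszul (false :: p) (x.+1 :: y.+1 :: 0%N :: map S s) = koszul p (x :: y :: s).
Proof.
rewrite -[RHS]koszul_even_cons !koszulE; congr (_ ^+ _).
rewrite inversions_filter [RHS]inversions_filter /=.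
by case: ifP => //; case: ifP.
Qed.

Lemma koszul_even_last (p : seq bool) s :
  koszul (rcons p false) s = koszul p [seq l <- s | l != size p].
Proof.
rewrite !koszulE; congr (_ ^+ _).
have eq_p : nth false (rcons p false) =1 nth false p.
  move=> k; rewrite nth_rcons; case: ltnP => // /(nth_default false) ->.
  by case: ifP.
rewrite (eq_inversions _ eq_p) inversions_filter [RHS]inversions_filter.
rewrite -filter_predI; congr inversions; apply: eq_filter => l /=.
by have [->|_] := eqVneq l (size p); rewrite ?andbT // nth_default.
Qed.

End Koszul.
(** * Cyclic symmetry of the bracket of two words *)

Section Words.

Variable S : odd_space.

Implicit Types (a b c u v w : word S).

Lemma wpar_cat u v : wpar (u ++ v) = wpar u (+) wpar v.
Proof. by rewrite /wpar count_cat oddD. Qed.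

Lemma wpar_cons (x : S) v : wpar (x :: v) = par x (+) wpar v.
Proof. by rewrite /wpar /= oddD oddb. Qed.

Lemma hzeroP (f : wser S) :
  hzero f <-> exists A : wser S, forall w, f w = A w - rotw A w.
Proof.
split=> -[A fA]; exists A; first by move=> w; rewrite fA.
by apply/funext => w; rewrite fA.
Qed.

Lemma hzero0 : hzero ((fun=> 0) : wser S).
Proof.
by apply/hzeroP; exists (fun=> 0) => w; rewrite /rotw mulr0 subrr.
Qed.

Lemma hzeroD (f g : wser S) : hzero f -> hzero g -> hzero (fun w => f w + g w).
Proof.
move=> /hzeroP[A fA] /hzeroP[B gB]; apply/hzeroP; exists (fun w => A w + B w).
by move=> w; rewrite fA gB /rotw; ring.
Qed.

Lemma hzeroZ q (f : wser S) : hzero f -> hzero (fun w => q * f w).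
Proof.
move=> /hzeroP[A fA]; apply/hzeroP; exists (fun w => q * A w).
by move=> w; rewrite fA /rotw; ring.
Qed.

Lemma hzero_sum (I : Type) (r : seq I) (P : pred I) (f : I -> wser S) :
  (forall i, P i -> hzero (f i)) -> hzero (fun w => \sum_(i <- r | P i) f i w).
Proof.
move=> f0; elim: r => [|i r IHr].
  by under eq_fun do rewrite big_nil; exact: hzero0.
under eq_fun do rewrite big_cons.
by case Pi: (P i) => //; exact: hzeroD (f0 _ Pi) IHr.
Qed.

(** Rotation preserves length, so primitives found for each length separately glue together. *)
Lemma hzero_size (f : wser S) :
  (forall n, exists2 f', hzero f' & forall w, size w = n -> f w = f' w) ->
  hzero f.
Proof.
move=> f_loc; have /choice[A fA] n : exists A : wser S,
    forall w, size w = n -> f w = A w - rotw A w.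
  have [f' /hzeroP[A f'A] ff'] := f_loc n; exists A => w /ff' ->; exact: f'A.
apply/hzeroP; exists (fun w => A (size w) w) => w.
by rewrite (fA (size w)) // /rotw size_rotr.
Qed.

(** The letters of [u] move to the end one at a time, each by one application of the cyclic
    generator; the signs multiply to that of exchanging [u] and [v]. *)
Lemma hzero_rot u v :
  hzero ((fun c => (u ++ v == c)%:R
    - (-1) ^+ (wpar u && wpar v) * (v ++ u == c)%:R) : wser S).
Proof.
elim: u v => [|x u IHu] v.
  by under eq_fun do rewrite cats0 mul1r subrr; exact: hzero0.
pose e : rat := (-1) ^+ (par x && wpar (u ++ v)).
have step : hzero ((fun c =>
    (x :: u ++ v == c)%:R - e * (u ++ rcons v x == c)%:R) : wser S).
  apply/hzeroP; exists (fun c => (x :: u ++ v == c)%:R) => c; congr (_ - _).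
  rewrite /rotw -rcons_cat.
  have -> : (rcons (u ++ v) x == c) = (x :: u ++ v == rotr 1 c).
    by rewrite -rot1_cons (can2_eq (rotK 1) (rotrK 1)).
  have [<-|_] := eqVneq; last by rewrite !mulr0.
  by rewrite /rot_sign /= take0 drop0 wpar_cons addbF.
have := hzeroD step (hzeroZ e (IHu (rcons v x))).
congr hzero; apply/funext => c.
rewrite mulrBr addrA subrK mulrA cat_rcons; congr (_ - _ * _).
rewrite /e -signr_addb -cats1 !wpar_cat !wpar_cons addbF; congr (_ ^+ nat_of_bool _).
by case: (par x) (wpar u) (wpar v) => [] [] [].
Qed.

Lemma cut_cat (T : Type) (r s : seq T) x :
  cut (size r) (r ++ x :: s) = s ++ r.
Proof. by rewrite /cut rot_size_cat. Qed.

Lemma cut_iota i m n : (i < n)%N ->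
  cut i (iota m n) = iota (m + i.+1) (n - i.+1) ++ iota m i.
Proof.
move=> lt_in; rewrite /cut /rot drop_iota take_iota (minn_idPl (ltnW lt_in)).
by rewrite -{1}(subnK lt_in) addnS subSn ?leq_addl ?addnK //= addnS.
Qed.

Lemma count_nth_iota_mid (T : Type) (f : T -> bool) (r s t : seq T) k :
  k = size r ->
  count (nth false (map f (r ++ s ++ t))) (iota k (size s)) = count f s.
Proof.
move=> ->; rewrite count_nth_iota ?size_cat; last by lia.
by rewrite drop_size_cat // take_size_cat.
Qed.

(** In the exponent, [x] passes [a1], [y] passes [a1], [a2] and [b1], then [a2] passes [a1] and [b2]
    passes [b1]. *)
Lemma koszul_bracket (x y : S) (a1 a2 b1 b2 : word S) :
  let a := a1 ++ x :: a2 in let b := b1 ++ y :: b2 in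
  koszul (map (@par S) (a ++ b))
    (size a1 :: (size a + size b1)%N ::
      cut (size a1) (iota 0 (size a)) ++ cut (size b1) (iota (size a) (size b)))
  = (-1) ^+ ((par x && wpar a1) (+) (par y && wpar (a1 ++ a2 ++ b1))
       (+) (wpar a2 && wpar a1) (+) (wpar b2 && wpar b1)).
Proof.
move=> a b; rewrite koszulE -signr_odd; congr (_ ^+ nat_of_bool _).
set p := nth false _.
have sa : size a = (size a1 + (size a2).+1)%N by rewrite size_cat.
have sb : size b = (size b1 + (size b2).+1)%N by rewrite size_cat.
have px : p (size a1) = par x.
  rewrite /p (nth_map x); last by rewrite !size_cat /=; lia.
  by rewrite /a -catA nth_cat ltnn subnn.
have py : p (size a + size b1)%N = par y.
  rewrite /p (nth_map x); last by rewrite !size_cat /=; lia.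
  rewrite nth_cat.
  by rewrite ltnNge leq_addr /= addKn nth_cat ltnn subnn.
have ca1 : count p (iota 0 (size a1)) = count (@par S) a1.
  by rewrite -(@count_nth_iota_mid _ _ [::] _ (x :: a2 ++ b) 0) // /p /a -catA.
have ca2 : count p (iota (size a1).+1 (size a2)) = count (@par S) a2.
  rewrite -(@count_nth_iota_mid _ _ (rcons a1 x) _ b (size a1).+1) ?size_rcons //.
  by rewrite /p /a cat_rcons -catA.
have cb1 : count p (iota (size a) (size b1)) = count (@par S) b1.
  by rewrite -(@count_nth_iota_mid _ _ a _ (y :: b2) (size a)).
have cb2 : count p (iota (size a + (size b1).+1) (size b2)) = count (@par S) b2.
  rewrite -(@count_nth_iota_mid _ _ (a ++ rcons b1 y) _ [::]
    (size a + (size b1).+1)).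
    by rewrite /p cats0 -catA cat_rcons.
  by rewrite size_cat size_rcons.
have lt0 z k l : (z <= k)%N ->
    count (fun t => [&& (t < z)%N, p z & p t]) (iota k l) = 0%N.
  move=> zk; apply/eqP; rewrite -leqn0 leqNgt -has_count; apply/hasPn => t.
  by rewrite mem_iota => /andP[kt _]; rewrite ltnNge (leq_trans zk kt).
have lt1 z k l : (k + l <= z)%N ->
    count (fun t => [&& (t < z)%N, p z & p t]) (iota k l) = (p z * count p (iota k l))%N.
  move=> klz; case pz: (p z); last first.
    by rewrite (eq_count (a2 := pred0)) ?count_pred0 // => t; rewrite andbF.
  rewrite mul1n; apply: eq_in_count => t; rewrite mem_iota => /andP[_ tkl].
  by rewrite (leq_trans tkl klz).
rewrite !cut_iota ?sa ?sb; [|lia|lia].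
have -> : (size a1 + (size a2).+1 - (size a1).+1)%N = size a2 by lia.
have -> : (size b1 + (size b2).+1 - (size b1).+1)%N = size b2 by lia.
have nlt : (size a + size b1 < size a1)%N = false by lia.
rewrite -sa /= add0n nlt /= !count_cat.
rewrite (lt0 _ (size a1).+1) // (lt1 (size a1) 0%N) //.
rewrite (lt0 (size a1) (size a + _)%N); last by lia.
rewrite (lt0 (size a1) (size a)); last by lia.
rewrite (lt1 _ (size a1).+1); last by lia.
rewrite (lt1 _ 0%N (size a1)); last by lia.
rewrite (lt0 _ (size a + (size b1).+1)%N); last by lia.
rewrite (lt1 _ (size a)) //.
rewrite inversions_cat_lt; last first.
  by move=> s t; rewrite !mem_cat !mem_iota; lia.
rewrite !inversions_cat_gt; try by move=> s t; rewrite !mem_iota; lia.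
rewrite !inversions_iota px py ca1 ca2 cb1 cb2 !wpar_cat /wpar !(oddD, oddM, oddb).
case: (par x) (par y) => [] []; move: (odd (count _ a1)) (odd (count _ a2))
  (odd (count _ b1)) (odd (count _ b2)) => [] [] [] [] //=.
Qed.

Hypothesis pairC : forall x y : S, pair x y = pair y x.
Hypothesis pair_odd : forall x y : S, pair x y != 0 -> par x != par y.

(** Contracting the same two letters in either order gives [a2 a1 b2 b1] and [b2 b1 a2 a1],
    rotations of each other. As [a] is even and contracted letters have opposite parities, the two
    signs differ by the Koszul sign of this rotation. *)
Lemma word_bracketC a b : wpar a = false ->
  hzero ((fun c => word_bracket a b (fun c' => (c' == c)%:R)
                - word_bracket b a (fun c' => (c' == c)%:R)) : wser S).
Proof.
move=> a_even.
under eq_fun do rewrite /word_bracket [X in _ - X]exchange_big -sumrB /=.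
apply: hzero_sum => i _; under eq_fun do rewrite -sumrB.
apply: hzero_sum => j _.
(* Any letter serves here, as the default value of [nth]. *)
have z : S := tnth (in_tuple a) i.
rewrite !(tnth_nth z) /= (pairC (nth z b j)).
have [xy0|/pair_odd xy] := eqVneq (pair (nth z a i) (nth z b j)) 0.
  by under eq_fun do rewrite xy0 !mulr0 !mul0r subrr; exact: hzero0.
move: xy a_even.
have si : size (take i a) = i by rewrite size_takel // ltnW.
have sj : size (take j b) = j by rewrite size_takel // ltnW.
have := cat_take_drop i a; rewrite (drop_nth z) // => /esym.
have := cat_take_drop j b; rewrite (drop_nth z) // => /esym.
move: (nth z a i) (nth z b j) (take i a) (take j b) (drop _ a) (drop _ b) si sj.
move=> x y a1 b1 a2 b2 <- <- -> -> xy a_even.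
under eq_fun do rewrite !koszul_bracket !cut_cat.
set e := (-1) ^+ _; set e' := (-1) ^+ _; set q := pair x y.
have -> : e' = e * (-1) ^+ (wpar (a2 ++ a1) && wpar (b2 ++ b1)).
  rewrite /e /e' -signr_addb; congr (_ ^+ nat_of_bool _).
  move: xy a_even; rewrite !wpar_cat wpar_cons.
  by case: (par x) (par y) (wpar a1) (wpar a2) (wpar b1) (wpar b2) =>
    [] [] [] [] [] [].
have := hzeroZ (e * q) (hzero_rot (a2 ++ a1) (b2 ++ b1)).
by congr hzero; apply/funext => c; ring.
Qed.

End Words.
(** * The operator delta on products of words *)

Section TensorSums.

Variable S : odd_space.

Implicit Types (w : word S) (s t : tensor S) (f : tensor S -> rat).

(** The sum over tuples in [delta] as an iterated sum, so that the first or last word can be split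
    off and the bound [M] changed. *)
Fixpoint tsum M k f : rat :=
  if k is k'.+1 then \sum_(w : M.-bseq S) tsum M k' (fun s => f (val w :: s))
  else f [::].

Lemma tsumE M k f :
  \sum_(s : k.-tuple (M.-bseq S)) f (map val s) = tsum M k f.
Proof.
elim: k f => [|k IHk] f /=.
  by rewrite (big_pred1 (nil_tuple _)) // => s; apply/esym/eqP; exact: tuple0.
under [RHS]eq_bigr do rewrite -IHk; rewrite pair_bigA /=.
rewrite (reindex (fun p : M.-bseq S * k.-tuple (M.-bseq S) => cons_tuple p.1 p.2)) //=.
exists (fun s : k.+1.-tuple (M.-bseq S) => (thead s, behead_tuple s)) => [[w s] _|s _] /=.
  by rewrite theadE; congr (_, _); apply: val_inj.
by rewrite [RHS]tuple_eta; apply: val_inj.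
Qed.

Lemma tsum_rcons M k f :
  tsum M k.+1 f = \sum_(w : M.-bseq S) tsum M k (fun s => f (rcons s (val w))).
Proof.
elim: k f => [|k IHk] f //.
rewrite -[LHS]/(\sum_(w : M.-bseq S) tsum M k.+1 (fun s => f (val w :: s))).
by under eq_bigr do rewrite IHk; rewrite exchange_big.
Qed.

Lemma eq_tsum M k f f' :
  (forall s, size s = k -> f s = f' s) -> tsum M k f = tsum M k f'.
Proof.
elim: k f f' => [|k IHk] f f' eq_f /=; first exact: eq_f.
by apply: eq_bigr => w _; apply: IHk => s sk; apply: eq_f; rewrite /= sk.
Qed.

Lemma tsumD M k f f' :
  tsum M k (fun s => f s + f' s) = tsum M k f + tsum M k f'.
Proof.
elim: k f f' => [|k IHk] f f' //=.
by rewrite -big_split; apply: eq_bigr => w _; rewrite IHk.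
Qed.

Lemma tsumZ M k q f : tsum M k (fun s => q * f s) = q * tsum M k f.
Proof.
elim: k f => [|k IHk] f //=.
by rewrite big_distrr; apply: eq_bigr => w _; rewrite IHk.
Qed.

Lemma tsumB M k f f' :
  tsum M k (fun s => f s - f' s) = tsum M k f - tsum M k f'.
Proof.
rewrite -[- tsum M k f']mulN1r -tsumZ -tsumD.
by apply: eq_tsum => s _; rewrite mulN1r.
Qed.

Lemma tsum_neq0 M k f : tsum M k f != 0 -> exists2 s, size s = k & f s != 0.
Proof.
move=> nz; apply: contrapT => f0; case/eqP: nz.
rewrite (@eq_tsum _ _ _ (fun s => 0 * f s)) ?tsumZ ?mul0r // => s sk.
by rewrite mul0r; apply: contrapT => /eqP ?; apply: f0; exists s.
Qed.

Lemma tsum0 M k f : (forall s, size s = k -> f s = 0) -> tsum M k f = 0.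
Proof.
move=> f0; apply/eqP; apply: contraT => /tsum_neq0[s /f0 ->].
by rewrite eqxx.
Qed.

Lemma big_bseq_widen M M' (F : word S -> rat) : (M <= M')%N ->
  (forall w, (M < size w)%N -> F w = 0) ->
  \sum_(w : M'.-bseq S) F (val w) = \sum_(w : M.-bseq S) F (val w).
Proof.
move=> MM' F0; rewrite (bigID (fun w : M'.-bseq S => size w <= M)%N) /=.
rewrite [X in _ + X]big1 ?addr0 => [|w]; last by rewrite -ltnNge => /F0.
rewrite (reindex_onto (widen_bseq MM') (@insub_bseq M S \o val)) /=.
  apply: eq_bigl => w; rewrite size_bseq /=; apply/eqP/val_inj.
  by rewrite val_insubd /= size_bseq.
by move=> w wM; apply: val_inj => /=; rewrite val_insubd wM.
Qed.

Lemma tsum_widen M M' k f : (M <= M')%N ->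
  (forall s, size s = k -> f s != 0 -> all (fun w => size w <= M)%N s) ->
  tsum M' k f = tsum M k f.
Proof.
move=> MM'; elim: k f => [|k IHk] f f0 //=.
rewrite (big_bseq_widen (F := fun w => tsum M' k (fun s => f (w :: s))) MM').
  apply: eq_bigr => w _; apply: IHk => s sk /f0 /=.
  by rewrite sk => /(_ erefl)/andP[].
move=> w Mw; apply/eqP; apply: contraTT Mw => /tsum_neq0[s sk /f0].
by rewrite /= sk -leqNgt => /(_ erefl)/andP[].
Qed.

Lemma hzero_tsum M k (F : tensor S -> wser S) :
  (forall s, size s = k -> hzero (F s)) -> hzero (fun c => tsum M k (fun s => F s c)).
Proof.
elim: k F => [|k IHk] F F0 /=; first exact: F0.
apply: hzero_sum => w _; apply: (IHk (fun s => F (val w :: s))) => s sk.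
by apply: F0; rewrite /= sk.
Qed.

Lemma word_bracketZ (a b : word S) q phi :
  word_bracket a b (fun c => q * phi c) = q * word_bracket a b phi.
Proof.
rewrite /word_bracket big_distrr; apply: eq_bigr => i _.
by rewrite big_distrr; apply: eq_bigr => j _ /=; ring.
Qed.

Lemma tensor_deltaZ s q phi :
  tensor_delta s (fun c => q * phi c) = q * tensor_delta s phi.
Proof.
rewrite /tensor_delta big_distrr; apply: eq_bigr => j _.
rewrite big_distrr; apply: eq_bigr => i _ /=.
by rewrite word_bracketZ; ring.
Qed.

Lemma big_lt_recl n (T : nat -> nat -> rat) :
  \sum_(j < n.+1) \sum_(i < n.+1 | (i < j)%N) T i j =
  \sum_(j < n) T 0%N j.+1 + \sum_(j < n) \sum_(i < n | (i < j)%N) T i.+1 j.+1.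
Proof.
rewrite big_ord_recl [X in X + _]big_pred0 ?add0r // -big_split /=.
by apply: eq_bigr => j _; rewrite big_mkcond big_ord_recl -big_mkcond.
Qed.

Lemma big_lt_recr n (T : nat -> nat -> rat) :
  \sum_(j < n.+1) \sum_(i < n.+1 | (i < j)%N) T i j =
  \sum_(i < n) T i n + \sum_(j < n) \sum_(i < n | (i < j)%N) T i j.
Proof.
rewrite [LHS]big_ord_recr [LHS]addrC /=; congr (_ + _).
  rewrite big_mkcond big_ord_recr /= ltnn addr0.
  by apply: eq_bigr => i _; rewrite ltn_ord.
apply: eq_bigr => j _; rewrite big_mkcond big_ord_recr /= -big_mkcond.
by rewrite ltnNge ltnW ?addr0.
Qed.

Definition delete j s : tensor S :=
  [seq nth [::] s l | l <- iota 0 (size s) & l != j].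

Definition front_sign s j : rat :=
  koszul (map (@wpar S) s) (j :: [seq l <- iota 0 (size s) | l != j]).

(** Pairs containing [w] are separated from pairs inside [s]. For the latter the new bracket goes to
    the front, so [w] ends up in second place. *)
Lemma tensor_delta_cons w s phi : wpar w = false ->
  tensor_delta (w :: s) phi =
  \sum_(j < size s) front_sign s j
    * word_bracket w (nth [::] s j) (fun c => phi (c :: delete j s))
  + tensor_delta s (fun u => phi (take 1 u ++ w :: drop 1 u)).
Proof.
move=> w0; rewrite /tensor_delta /= w0.
rewrite (big_lt_recl _ (fun i j =>
  koszul (false :: map (@wpar S) s) (i :: j :: others i j (size s).+1)
  * word_bracket (nth [::] (w :: s) i) (nth [::] (w :: s) j)
    (fun c => phi (c ::
      [seq nth [::] (w :: s) l | l <- others i j (size s).+1])))).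
congr (_ + _).
  apply: eq_bigr => j _; rewrite others0 -map_comp.
  by rewrite (koszul_even_cons _ (nat_of_ord j :: _)).
apply: eq_bigr => j _; apply: eq_bigr => i _.
by rewrite othersS koszul_even_mid /= -map_comp drop0 take0.
Qed.

(** The same separation with [w] at the end: it is now the second argument of its brackets, and
    otherwise stays last. *)
Lemma tensor_delta_rcons w s phi : wpar w = false ->
  tensor_delta (rcons s w) phi =
  \sum_(j < size s) front_sign s j
    * word_bracket (nth [::] s j) w (fun c => phi (c :: delete j s))
  + tensor_delta s (fun u => phi (rcons u w)).
Proof.
move=> w0; rewrite /tensor_delta size_rcons map_rcons w0.
rewrite (big_lt_recr _ (fun i j =>
  koszul (rcons (map (@wpar S) s) false) (i :: j :: others i j (size s).+1)
  * word_bracket (nth [::] (rcons s w) i) (nth [::] (rcons s w) j)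
    (fun c => phi (c ::
      [seq nth [::] (rcons s w) l | l <- others i j (size s).+1])))).
have nth_s l : (l < size s)%N -> nth [::] (rcons s w) l = nth [::] s l.
  by move=> ls; rewrite nth_rcons ls.
congr (_ + _).
  apply: eq_bigr => j _; rewrite others_last // koszul_even_last /= size_map.
  rewrite eqxx (ltn_eqF (ltn_ord j)) /= nth_s // nth_rcons ltnn eqxx.
  congr (_ * _).
    rewrite /front_sign -filter_predI; congr (koszul _ (_ :: _)).
    apply: eq_in_filter => l; rewrite mem_iota /= => l_s.
    by rewrite [l != size s]neq_ltn l_s.
  congr word_bracket; apply/funext => c; congr (phi (_ :: _)).
  apply/eq_in_map => l; rewrite mem_filter mem_iota => /andP[_ l_s].
  exact: nth_s.
apply: eq_bigr => j _; apply: eq_bigr => i _.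
rewrite others_rcons // koszul_even_last /= size_map.
rewrite !(ltn_eqF (ltn_ord _)) /= !nth_s // filter_rcons eqxx /=.
congr (koszul _ (_ :: _ :: _) * _).
  rewrite -[RHS]filter_predT; apply: eq_in_filter => l.
  by rewrite mem_filter mem_iota /= => /andP[_ l_s]; rewrite neq_ltn l_s.
congr word_bracket; apply/funext => c; rewrite map_rcons nth_rcons ltnn eqxx.
congr (phi (_ :: rcons _ _)).
apply/eq_in_map => l; rewrite mem_filter mem_iota => /andP[_ l_s].
exact: nth_s.
Qed.

(** A bracket of two words removes two letters in all, so the cut-off on word lengths in [delta]
    omits no contributing tensor. *)
Lemma tensor_delta_bounded s t :
  tensor_delta s (fun u => (u == t)%:R) != 0 ->
  all (fun w => size w <= (letters t).+2)%N s.
Proof.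
apply: contraNT; rewrite -has_predC => /(has_nthP [::])[l ls /= lt_t].
rewrite -ltnNge in lt_t.
apply/eqP; apply: big1 => j _; apply: big1 => i _.
suff -> : word_bracket (nth [::] s i) (nth [::] s j)
    (fun w => (w :: [seq nth [::] s l0 | l0 <- others i j (size s)] == t)%:R) = 0.
  by rewrite mulr0.
apply: big1 => i' _; apply: big1 => j' _.
case: eqP => [t_eq|]; rewrite ?mulr0 //; move: lt_t; rewrite ltnNge -t_eq.
move: (ltn_ord i') (ltn_ord j') => lt_i lt_j.
rewrite /letters /= !size_cat /cut !size_behead !size_rot.
have [->|li] := eqVneq l (i : nat); first by lia.
have [->|lj] := eqVneq l (j : nat); first by lia.
have : nth [::] s l \in [seq nth [::] s l0 | l0 <- others i j (size s)].
  by apply: map_f; rewrite mem_filter li lj mem_iota.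
move: [seq _ | _ <- _] => r; set a := nth _ s l.
suff : a \in r -> (size a <= size (flatten r))%N by move=> le_a /le_a; lia.
elim: r => //= b r IHr; rewrite inE size_cat => /orP[/eqP->|/IHr]; lia.
Qed.

End TensorSums.
(** * Symmetry of the bracket with a single even word *)

Section BracketSymmetry.

Variable S : odd_space.

Implicit Types (F G : ser S) (h : wser S).

Lemma mul_nil_embedl h F g : mul (embed h) F g [::] = 0.
Proof.
rewrite /mul big1 // => i _; rewrite big_ord1 /=.
by case: (i : nat) => [|?]; rewrite mul0r.
Qed.

Lemma mul_nil_embedr h F g : mul F (embed h) g [::] = 0.
Proof.
rewrite /mul big1 // => i _; rewrite big_ord1 /=.
by case: (_ - _)%N => [|?]; rewrite mulr0.
Qed.

Lemma mul_cons_embedl h F g w s : mul (embed h) F g (w :: s) = h w * F g s.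
Proof.
rewrite /mul big_ord_recl [X in _ + X]big1 ?addr0 => [|i _]; last first.
  by rewrite big1 // => k _; rewrite mul0r.
rewrite big_ord_recl /= mul0r add0r big_ord_recl /= take0 drop0 subn0.
rewrite big1 ?addr0 // => k _; rewrite /bump /=.
by case: s k => [|a s] [[|k] //= k_s]; rewrite mul0r.
Qed.

Lemma mul_rcons_embedr h F g w s : mul F (embed h) g (rcons s w) = F g s * h w.
Proof.
rewrite /mul big_ord_recr /= [X in X + _]big1 ?add0r => [|i _]; last first.
  rewrite big1 // => k _; rewrite -[(g - i)%N]prednK ?subn_gt0 //.
  by rewrite mulr0.
rewrite size_rcons big_ord_recr /= subnn drop_oversize ?size_rcons // mulr0.
rewrite addr0 big_ord_recr /= -cats1 take_size_cat // drop_size_cat //.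
rewrite big1 ?add0r // => k _; rewrite drop_cat /= ltn_ord.
rewrite (drop_nth [::] (ltn_ord k)) /=.
by case: (drop _ _) => [|? ?]; rewrite mulr0.
Qed.

Lemma deltaE F g t :
  delta F g t = tsum (letters t).+2 (size t).+1
    (fun s => F g s * tensor_delta s (fun t' => (t' == t)%:R)).
Proof. by rewrite -tsumE. Qed.

Lemma tensor_delta_nil s :
  tensor_delta s (fun t => (t == [::] :> tensor S)%:R) = 0.
Proof.
rewrite /tensor_delta big1 // => j _; rewrite big1 // => i _.
rewrite /word_bracket big1 ?mulr0 // => k _.
by rewrite big1 // => l _; rewrite mulr0.
Qed.

Lemma delta_nil F g : delta F g [::] = 0.
Proof.
by rewrite /delta big1 // => s _; rewrite tensor_delta_nil mulr0.
Qed.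

(** Lets coefficients at tensors with different numbers of letters be computed over a common
    range. *)
Lemma delta_widen M F g t : ((letters t).+2 <= M)%N ->
  tsum M (size t).+1
    (fun s => F g s * tensor_delta s (fun t' => (t' == t)%:R)) = delta F g t.
Proof.
move=> tM; rewrite deltaE; apply: tsum_widen => // s _.
by rewrite mulf_eq0 => /norP[_]; exact: tensor_delta_bounded.
Qed.

Lemma tensor_delta_small (s : tensor S) phi : (size s <= 1)%N -> tensor_delta s phi = 0.
Proof.
move=> s1; apply: big1 => j _; apply: big_pred0 => i.
by have := ltn_ord j; lia.
Qed.

Lemma delta_embed h : delta (embed h) = 0.
Proof.
apply/funext => g; apply/funext => t; rewrite /delta big1 // => s _.
case: g => [|g]; last by rewrite mul0r.
case: (map val s) => [|w [|? ?]]; rewrite /= ?mul0r //;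
  by rewrite tensor_delta_small ?mulr0.
Qed.

Section EvenWords.

Variable h : wser S.
Hypothesis h_even : forall w, h w != 0 -> wpar w = false.

Lemma sgn_embed : sgn (embed h) = embed h.
Proof.
apply/funext => g; apply/funext => s; rewrite /sgn.
case: g s => [|g] [|w [|? ?]]; rewrite /= ?mulr0 //.
rewrite /tpar /embed /= addn0 oddb.
have [->|/h_even w0] := eqVneq (h w) 0; first by rewrite mulr0.
by rewrite w0 mul1r.
Qed.

Lemma delta_mul_embedl F g t :
  delta (mul (embed h) F) g t =
  \sum_(w : (letters t).+2.-bseq S) h (val w) * tsum (letters t).+2 (size t)
    (fun s => F g s * tensor_delta (val w :: s) (fun t' => (t' == t)%:R)).
Proof.
rewrite deltaE /=; apply: eq_bigr => w _; rewrite -tsumZ; apply: eq_tsum => s _.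
by rewrite mul_cons_embedl mulrA.
Qed.

Lemma delta_mul_embedr F g t :
  delta (mul F (embed h)) g t =
  \sum_(w : (letters t).+2.-bseq S) h (val w) * tsum (letters t).+2 (size t)
    (fun s => F g s * tensor_delta (rcons s (val w)) (fun t' => (t' == t)%:R)).
Proof.
rewrite deltaE tsum_rcons; apply: eq_bigr => w _; rewrite -tsumZ.
by apply: eq_tsum => s _; rewrite mul_rcons_embedr; ring.
Qed.

(* The terms of delta (h F) - delta (F h) in which h is one of the two words *)
(* that get bracketed. *)
Definition contraction F : ser S := fun g t =>
  \sum_(w : (letters t).+2.-bseq S) h (val w) * tsum (letters t).+2 (size t)
    (fun s => F g s * \sum_(j < size s) front_sign s j
      * (word_bracket (val w) (nth [::] s j) (fun c => (c :: delete j s == t)%:R)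
        - word_bracket (nth [::] s j) (val w)
            (fun c => (c :: delete j s == t)%:R))).

(** In the last two sums [h] is a spectator: in second place for the product [h F], in last place
    for [F h]. *)
Lemma delta_commutator F g t :
  delta (mul (embed h) F) g t - delta (mul F (embed h)) g t =
  contraction F g t +
  (\sum_(w : (letters t).+2.-bseq S) h (val w) * tsum (letters t).+2 (size t)
    (fun s => F g s * tensor_delta s
      (fun u => (take 1 u ++ val w :: drop 1 u == t)%:R))
  - \sum_(w : (letters t).+2.-bseq S) h (val w) * tsum (letters t).+2 (size t)
    (fun s => F g s * tensor_delta s (fun u => (rcons u (val w) == t)%:R))).
Proof.
rewrite delta_mul_embedl delta_mul_embedr /contraction -!sumrB -big_split.
apply: eq_bigr => w _ /=; have [->|/h_even w0] := eqVneq (h (val w)) 0.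
  by rewrite !mul0r !subr0 ?addr0.
rewrite -!mulrBr -mulrDr; congr (_ * _); rewrite -!tsumB -tsumD.
apply: eq_tsum => s _; rewrite tensor_delta_cons // tensor_delta_rcons //.
rewrite -!mulrBr -mulrDr; congr (_ * _).
under [in RHS]eq_bigr do rewrite mulrBr.
by rewrite sumrB; ring.
Qed.

Lemma sum_pick M (v : word S) (q : word S -> rat) : (size v <= M)%N ->
  \sum_(w : M.-bseq S) q (val w) * (val w == v)%:R = q v.
Proof.
move=> vM; rewrite (bigD1 (Bseq vM)) //= eqxx mulr1 big1 ?addr0 // => w wv.
by rewrite (negPf (_ : val w != v)) ?mulr0.
Qed.

Lemma delta_rcons_even F g t :
  \sum_(w : (letters t).+2.-bseq S) h (val w) * tsum (letters t).+2 (size t)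
    (fun s => F g s * tensor_delta s (fun u => (rcons u (val w) == t)%:R))
  = mul (delta F) (embed h) g t.
Proof.
case/lastP: t => [|t v].
  rewrite mul_nil_embedr big1 // => w _ /=.
  under [fun u => _]eq_fun do rewrite -size_eq0 size_rcons.
  (* No [rcons] is empty, so the functional vanishes; it is written as $0\cdot0$ for [tensor_deltaZ]
     to apply. *)
  by rewrite -[fun=> _](eq_fun (fun u => mul0r (0 : rat))) tensor_deltaZ mul0r !mulr0.
rewrite mul_rcons_embedr mulrC -(@sum_pick (letters (rcons t v)).+2); last first.
  by rewrite /letters flatten_rcons size_cat; lia.
rewrite big_distrl /=; apply: eq_bigr => w _; rewrite -mulrA; congr (_ * _).
rewrite -(@delta_widen (letters (rcons t v)).+2); last first.
  by rewrite /letters flatten_rcons size_cat; lia.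
rewrite size_rcons -tsumZ; apply: eq_tsum => s _.
rewrite mulrCA; congr (_ * _); rewrite -tensor_deltaZ; congr tensor_delta.
by apply/funext => u; rewrite eqseq_rcons andbC -natrM mulnb.
Qed.

(** The right side is the coefficient of $h\,\delta F$ after exchanging the first two words. *)
Lemma delta_second_even F g t0 v t :
  \sum_(w : (letters [:: t0, v & t]).+2.-bseq S) h (val w)
    * tsum (letters [:: t0, v & t]).+2 (size [:: t0, v & t])
    (fun s => F g s * tensor_delta s
      (fun u => (take 1 u ++ val w :: drop 1 u == [:: t0, v & t])%:R))
  = h v * delta F g (t0 :: t).
Proof.
rewrite -(@sum_pick (letters [:: t0, v & t]).+2); last first.
  by rewrite /letters /= !size_cat; lia.
rewrite mulr_suml; apply: eq_bigr => w _; rewrite -mulrA; congr (_ * _).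
rewrite -(@delta_widen (letters [:: t0, v & t]).+2); last first.
  by rewrite /letters /= !size_cat; lia.
rewrite -tsumZ. apply: eq_tsum => s _.
rewrite mulrCA; congr (_ * _); rewrite -tensor_deltaZ.
rewrite /tensor_delta; apply: eq_bigr => j _; apply: eq_bigr => i _.
congr (_ * _); congr word_bracket; apply/funext => c.
by rewrite /= drop0 take0 /= !eqseq_cons andbCA -natrM mulnb.
Qed.

Hypothesis pairC : forall x y : S, pair x y = pair y x.
Hypothesis pair_odd : forall x y : S, pair x y != 0 -> par x != par y.

(** The rotation primitive is chosen separately for each power of $\gamma$ and each tail, and acts
    on the first word only. *)
Lemma lzero_head F :
  (forall g, F g [::] = 0) ->
  (forall g t, hzero ((fun c => F g (c :: t)) : wser S)) -> lzero F.
Proof.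
move=> F0 Fh; have /choice[A FA] (gt : nat * tensor S) : exists A : wser S,
    forall c, F gt.1 (c :: gt.2) = A c - rotw A c by apply/hzeroP.
exists (fun i g s => if (i, s) is (0%N, c :: t) then A (g, t) c else 0).
exists (fun _ _ _ => 0) => g [|c t]; first by rewrite F0 !big_ord0 addr0.
rewrite (FA (g, t)) big_ord_recl big1 => [|i _]; last first.
  by rewrite !fctE /rots /= mulr0 subr0.
rewrite big1 ?addr0 // => i _.
by rewrite !fctE /swaps mulr0 subr0.
Qed.

Lemma lzero_swap F : lzero (fun g s => if (1 < size s)%N then (F - swaps 0 F) g s else 0).
Proof.
exists (fun _ _ _ => 0), (fun i => if i is 0%N then F else 0) => g s.
rewrite big1 ?add0r => [|i _]; last by rewrite !fctE /rots mulr0 subr0.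
case: s => [|u [|v s]]; rewrite /= ?big_ord0 // big_ord_recl.
rewrite big1 ?addr0 // => i _.
by rewrite !fctE /swaps mulr0 subr0.
Qed.

Lemma lzeroB F G : lzero F -> lzero G -> lzero (F - G).
Proof.
move=> [A [B FE]] [A' [B' GE]]; exists (A - A'), (B - B') => g s.
rewrite !fctE FE GE opprD addrACA -!sumrB; congr (_ + _); apply: eq_bigr => i _.
  by rewrite /rots !fctE; ring.
by rewrite /swaps !fctE; ring.
Qed.

Lemma lzero_contraction F : lzero (contraction F).
Proof.
apply: lzero_head => [g|g t].
  rewrite /contraction big1 // => w _; rewrite /= [X in _ * X](_ : _ = 0) ?mulr0 //.
  by rewrite big_ord0 mulr0.
(* The range of summation depends on [c] through its length; fixing that length makes the bound a
   constant [M]. *)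
apply: hzero_size => n; pose M := (n + letters t).+2.
exists (fun c => \sum_(w : M.-bseq S) h (val w) * tsum M (size t).+1
    (fun s => F g s * \sum_(j < size s) front_sign s j
      * (word_bracket (val w) (nth [::] s j)
            (fun c' => (c' :: delete j s == c :: t)%:R)
        - word_bracket (nth [::] s j) (val w)
            (fun c' => (c' :: delete j s == c :: t)%:R)))); last first.
  by move=> c cn; rewrite /contraction /letters /= size_cat cn.
apply: hzero_sum => w _; have [->|/h_even w0] := eqVneq (h (val w)) 0.
  by under eq_fun do rewrite mul0r; exact: hzero0.
apply/hzeroZ/hzero_tsum => s _; apply: hzeroZ; apply: hzero_sum => j _.
apply: hzeroZ; have := hzeroZ (delete j s == t)%:R
  (word_bracketC pairC pair_odd (nth [::] s j) w0).
congr hzero; apply/funext => c; rewrite mulrBr -!word_bracketZ.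
by congr (_ - _); congr word_bracket; apply/funext => c';
  rewrite eqseq_cons andbC -natrM mulnb.
Qed.

(** Since $\delta h=0$ and $h$ is even, the difference is $\delta(hF)-\delta(Fh)-h\,\delta F+(\delta
    F)h$. The spectator terms with $h$ last cancel $(\delta F)h$; those with $h$ second match
    $h\,\delta F$ up to an exchange of words; the contraction remains. *)
Lemma bracket_embedC F : lzero (bracket (embed h) F - bracket F (embed h)).
Proof.
pose K := mul (embed h) (delta F).
have := lzeroB (lzero_contraction F) (lzero_swap K).
congr lzero; apply/funext => g; apply/funext => t.
rewrite /bracket sgn_embed delta_embed !fctE.
have -> : mul 0 F g t = 0.
  by apply: big1 => i _; apply: big1 => k _; rewrite mul0r.
have -> : mul (sgn F) 0 g t = 0.
  by apply: big1 => i _; apply: big1 => k _; rewrite mulr0.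
rewrite !subr0 -/K.
have := delta_commutator F g t; rewrite delta_rcons_even.
suff -> : \sum_(w : (letters t).+2.-bseq S) h (val w) * tsum (letters t).+2 (size t)
    (fun s => F g s * tensor_delta s
      (fun u => (take 1 u ++ val w :: drop 1 u == t)%:R))
  = K g t - (if (1 < size t)%N then (K - swaps 0 K) g t else 0).
  rewrite -[K g t - swaps _ _ _ _]/((K - swaps 0 K) g t).
  by move: (if _ then _ else _) => q E; lra.
(* On tensors of at most one word there is nothing to exchange, and both sides vanish. *)
case: t => [|t0 [|v t]].
- rewrite /K mul_nil_embedl subrr big1 // => w _.
  by rewrite tsum0 ?mulr0 // => s s0; rewrite tensor_delta_small ?s0 ?mulr0.
- rewrite /K mul_cons_embedl delta_nil mulr0 subrr big1 // => w _.
  by rewrite tsum0 ?mulr0 // => s s1; rewrite tensor_delta_small ?s1 ?mulr0.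
rewrite delta_second_even /swaps /K !fctE /= !mul_cons_embedl drop0.
have [->|/h_even ->] := eqVneq (h v) 0; first by ring.
by rewrite andbF; ring.
Qed.

End EvenWords.

End BracketSymmetry.
(** * The dual form *)

Section DualForm.

(** With [D] the diagonal matrix of parity signs, anticommutation says that [A] is odd; this is how
    oddness passes from the Gram matrix to its inverse. *)
Lemma invmx_anticomm (n : nat) (A D : 'M[rat]_n) :
  D *m A = - (A *m D) -> invmx A *m D = - (D *m invmx A).
Proof.
move=> DA; have [uA|nuA] := boolP (A \in unitmx); last first.
  by rewrite (invmx_out nuA) DA opprK.
have -> : invmx A *m D = invmx A *m (D *m A) *m invmx A.
  by rewrite !mulmxA mulmxK.
by rewrite DA mulmxN mulNmx mulmxA mulVmx // mul1mx.
Qed.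

Lemma invmxN (n : nat) (A : 'M[rat]_n) : invmx (- A) = - invmx A.
Proof.
have [uA|nuA] := boolP (- A \in unitmx).
  by rewrite -scaleN1r invmxZ ?scaleN1r // invrN1 scaleN1r.
rewrite !invmx_out ?inE //; move: nuA.
by rewrite !unitmxE -scaleN1r detZ unitrMr // unitrX // unitrN unitr1.
Qed.

Variables (W : vectType rat) (W0 W1 : {vspace W}) (form : {symmetric W}).
Hypothesis form_odd : odd_form W0 W1 form.

Lemma basisW_mem k :
  @basisW W W0 W1 k \in (if parW k then W1 else W0).
Proof.
rewrite /basisW /parW nth_cat size_tuple.
case: leqP => k0; apply: vbasis_mem; apply: mem_nth; rewrite size_tuple //.
by have := ltn_ord k; lia.
Qed.

Lemma gramV_odd k l : parW k = parW l -> gramV W0 W1 form k l = 0.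
Proof.
move=> kl; rewrite mxE; have := basisW_mem k; have := basisW_mem l.
rewrite -kl; case: form_odd => f0 f1.
by case: (parW k) => bl bk; rewrite ?(f0 _ _ bk bl) ?(f1 _ _ bk bl) mulr0.
Qed.

Lemma gramV_skew : (gramV W0 W1 form)^T = - gramV W0 W1 form.
Proof.
apply/matrixP => k l; rewrite [LHS]mxE [RHS]mxE.
have [kl|kl] := eqVneq (parW k) (parW l).
  by rewrite !gramV_odd ?oppr0.
rewrite !mxE (hermC form) expr0 mul1r /=.
by case: (parW k) (parW l) kl => [] [] //= _; ring.
Qed.

Lemma invmx_gramV_odd k l : parW k = parW l -> invmx (gramV W0 W1 form) k l = 0.
Proof.
move=> kl; pose d := \row_(k < _) ((-1) ^+ @parW W W0 W1 k : rat).
have /matrixP/(_ k l) : invmx (gramV W0 W1 form) *m diag_mx d =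
    - (diag_mx d *m invmx (gramV W0 W1 form)).
  apply: invmx_anticomm; apply/matrixP => i j.
  rewrite mul_diag_mx mul_mx_diag [LHS]mxE [RHS]mxE [X in - X]mxE.
  have [ij|ij] := eqVneq (parW i) (parW j).
    by rewrite gramV_odd // mulr0 mul0r oppr0.
  by rewrite ![d _ _]mxE; case: (parW i) (parW j) ij => [] [] //= _; ring.
rewrite mul_diag_mx mul_mx_diag [LHS]mxE [RHS]mxE [X in - X]mxE ![d _ _]mxE kl.
by case: (parW l) => /=; lra.
Qed.

(** The inverse Gram matrix is skew, and the sign in [dual_form] also changes when letters of
    opposite parity are exchanged. *)
Lemma PiDual_pairC (x y : PiDual W0 W1 form) : pair x y = pair y x.
Proof.
rewrite /= /dual_form /parV.
have [kl|kl] := eqVneq (parW x) (parW y).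
  by rewrite !invmx_gramV_odd ?mulr0.
have -> : invmx (gramV W0 W1 form) y x = - invmx (gramV W0 W1 form) x y.
  have := trmx_inv (gramV W0 W1 form); rewrite gramV_skew invmxN.
  by move=> /matrixP/(_ x y); rewrite [LHS]mxE [RHS]mxE.
by case: (parW x) (parW y) kl => [] [] //= _; ring.
Qed.

Lemma PiDual_pair_odd (x y : PiDual W0 W1 form) :
  pair x y != 0 -> par x != par y.
Proof.
apply: contraNneq => /= /negb_inj kl.
by rewrite /dual_form invmx_gramV_odd ?mulr0.
Qed.

End DualForm.
(** * The filtration by order *)

Section Filtration.

Variable S : odd_space.

Implicit Types (F G H : ser S) (c : rat) (m n p g : nat) (s t : tensor S).

Lemma serZE c F g s : (c *: F) g s = c * F g s.
Proof. by []. Qed.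

Lemma serDE F G g s : (F + G) g s = F g s + G g s.
Proof. by []. Qed.

Lemma serNE F g s : (- F) g s = - F g s.
Proof. by []. Qed.

Lemma ser_sumE (I : Type) (r : seq I) (P : pred I) (F : I -> ser S) g s :
  (\sum_(i <- r | P i) F i) g s = \sum_(i <- r | P i) F i g s.
Proof.
elim: r => [|i r IHr]; first by rewrite !big_nil.
by rewrite !big_cons; case: (P i); rewrite ?serDE IHr.
Qed.

Lemma serP F G : (forall g s, F g s = G g s) -> F = G.
Proof. by move=> FG; apply/funext => g; apply/funext => s. Qed.

Lemma mulBl F G H : mul (F - G) H = mul F H - mul G H.
Proof.
apply: serP => g s; rewrite serDE serNE /mul -sumrB.
apply: eq_bigr => i _; rewrite -sumrB; apply: eq_bigr => k _.
by rewrite -mulrBl.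
Qed.

Lemma sgnB F G : sgn (F - G) = sgn F - sgn G.
Proof. by apply: serP => g s; rewrite /sgn -[RHS]mulrBr. Qed.

Lemma bracketBl F G H : bracket (F - G) H = bracket F H - bracket G H.
Proof.
rewrite /bracket mulBl !deltaB sgnB !mulBl.
by apply: serP => g s; rewrite !(serDE, serNE); ring.
Qed.

Lemma bracketDl F G H : bracket (F + G) H = bracket F H + bracket G H.
Proof. by rewrite -{2}(addrK G F) bracketBl subrK. Qed.

Lemma bracketDr F G H : bracket F (G + H) = bracket F G + bracket F H.
Proof. by rewrite -{2}(addrK H G) bracketBr subrK. Qed.

Lemma bracketNr F G : bracket F (- G) = - bracket F G.
Proof. by rewrite -sub0r bracketBr bracket0r sub0r. Qed.

Lemma DeltaB F G : Delta (F - G) = Delta F - Delta G.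
Proof.
apply: serP => g t; rewrite serDE serNE /Delta -sumrB.
by apply: eq_bigr => s _; rewrite -mulrBl.
Qed.

Lemma diffB F G : diff (F - G) = diff F - diff G.
Proof.
rewrite /diff deltaB DeltaB; apply: serP => g s; rewrite !(serDE, serNE).
by case: g => [|g] /=; rewrite ?(serDE, serNE); ring.
Qed.

Lemma diffD F G : diff (F + G) = diff F + diff G.
Proof. by rewrite -{2}(addrK G F) diffB subrK. Qed.

Lemma sum_neq0 (I : finType) (q : I -> rat) :
  \sum_i q i != 0 -> exists i, q i != 0.
Proof.
move=> nz; apply: contrapT => q0; case/eqP: nz; apply: big1 => i _.
by apply: contrapT => /eqP qi; apply: q0; exists i.
Qed.

(** [order] before its truncated predecessor is taken, so that degrees add exactly. *)
Definition weight g s := (2 * g + size s)%N.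

Lemma mul_support F G g s : mul F G g s != 0 ->
  exists g1 s1 g2 s2, [/\ F g1 s1 != 0, G g2 s2 != 0
    & (weight g1 s1 + weight g2 s2 = weight g s)%N].
Proof.
move=> /sum_neq0[i /sum_neq0[k]]; rewrite mulf_eq0 negb_or => /andP[Fn Gn].
exists i, (take k s), (g - i)%N, (drop k s); split=> //.
rewrite /weight size_takel ?size_drop; last by have := ltn_ord k; lia.
by have := ltn_ord i; have := ltn_ord k; lia.
Qed.

Lemma delta_support F g t : delta F g t != 0 ->
  exists2 s, F g s != 0 & weight g s = (weight g t).+1.
Proof.
move=> /sum_neq0[s]; rewrite mulf_eq0 negb_or => /andP[Fn _].
by exists (map val s) => //; rewrite /weight size_map size_tuple addnS.
Qed.

Lemma bracket_support F G g t : bracket F G g t != 0 ->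
  exists g1 s1 g2 s2, [/\ F g1 s1 != 0, G g2 s2 != 0
    & (weight g1 s1 + weight g2 s2 = (weight g t).+1)%N].
Proof.
rewrite /bracket => /neq0B[/neq0B[]|].
- move=> /delta_support[s /mul_support[g1 [s1 [g2 [s2 [? ? <-]]]]] <-].
  by exists g1, s1, g2, s2.
- move=> /mul_support[g1 [s1 [g2 [s2 [/delta_support[s Fs s_s1] ? <-]]]]].
  by exists g1, s, g2, s2; split=> //; rewrite s_s1.
- move=> /mul_support[g1 [s1 [g2 [s2 []]]]].
  rewrite mulf_eq0 negb_or => /andP[_ ?] /delta_support[s Gs s_s2] <-.
  by exists g1, s1, g2, s; split=> //; rewrite s_s2 addnS.
Qed.

(** In $\gamma\delta$, the factor $\gamma$ adds 2 and merging two words costs 1; $\Delta$ splits one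
    word into two. *)
Lemma diff_support F g t : diff F g t != 0 ->
  exists g' s, F g' s != 0 /\ weight g t = (weight g' s).+1.
Proof.
have [Fg0|] := eqVneq (gamma_mul (delta F) g t) 0; last first.
  case: g => [|g]; rewrite /gamma_mul ?eqxx //.
  move=> /delta_support[s Fs w_s] _; exists g, s; split=> //.
  by rewrite w_s /weight mulnS.
rewrite /diff serDE Fg0 add0r => /sum_neq0[s].
(* For empty [t] the predecessor of its size is truncated to 0: the source is then the empty tensor,
   on which [tensor_Delta] is an empty sum. *)
rewrite mulf_eq0 negb_or => /andP[Fs]; case: t {Fg0} s Fs => [|w t] s Fs.
  by rewrite tuple0 /tensor_Delta /= big_ord0 eqxx.
move=> _; exists g, (map val s); split=> //.
by rewrite /weight size_map size_tuple /= addnS.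
Qed.

Definition weight_ge m F := forall g s, F g s != 0 -> (m <= weight g s)%N.

Lemma weight_geD m F G : weight_ge m F -> weight_ge m G -> weight_ge m (F + G).
Proof.
move=> mF mG g s; rewrite serDE.
have [->|/mF//] := eqVneq (F g s) 0; rewrite add0r; exact: mG.
Qed.

Lemma weight_geZ m c F : weight_ge m F -> weight_ge m (c *: F).
Proof. by move=> mF g s; rewrite serZE mulf_eq0 negb_or => /andP[_ /mF]. Qed.

Lemma weight_ge_sum (I : Type) (r : seq I) (P : pred I) (F : I -> ser S) m :
  (forall i, P i -> weight_ge m (F i)) -> weight_ge m (\sum_(i <- r | P i) F i).
Proof.
move=> mF; apply: big_ind => //; last exact: weight_geD.
Qed.

Lemma weight_ge_leq m m' F : weight_ge m' F -> (m <= m')%N -> weight_ge m F.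
Proof. by move=> mF mm' g s /mF; exact: leq_trans. Qed.

Lemma weight_ge_bracket a b F G :
  weight_ge a F -> weight_ge b G -> weight_ge (a + b).-1 (bracket F G).
Proof.
by move=> aF bG g t /bracket_support[g1 [s1 [g2 [s2 [/aF ? /bG ?]]]]]; lia.
Qed.

Lemma weight_ge_diff a F : weight_ge a F -> weight_ge a.+1 (diff F).
Proof. by move=> aF g t /diff_support[g' [s [/aF ? ->]]]. Qed.

Lemma homog_weight n F g s : homog n.+1 F -> F g s != 0 -> weight g s = n.+2.
Proof. by move=> nF /nF; rewrite /Defs.order /weight; lia. Qed.

Lemma weight_ge_homog n F : homog n.+1 F -> weight_ge n.+2 F.
Proof. by move=> nF g s /(homog_weight nF) ->. Qed.

Lemma embed_weight (h : wser S) g s : embed h g s != 0 -> weight g s = 1%N.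
Proof. by case: g s => [|g] [|w [|? ?]] //=; rewrite eqxx. Qed.

Lemma homog_bracket_embed n (h : wser S) F :
  homog n.+1 F -> homog n.+1 (bracket (embed h) F).
Proof.
move=> nF g t /bracket_support[g1 [s1 [g2 [s2 [hw]]]]].
by move=> /(homog_weight nF); rewrite (embed_weight hw) /Defs.order /weight; lia.
Qed.

Lemma homogD n F G : homog n F -> homog n G -> homog n (F + G).
Proof.
move=> nF nG g s; rewrite serDE.
have [->|/nF//] := eqVneq (F g s) 0; rewrite add0r; exact: nG.
Qed.

Lemma homogN n F : homog n F -> homog n (- F).
Proof. by move=> nF g s; rewrite serNE oppr_eq0; exact: nF. Qed.

Lemma has_parityD b F G :
  has_parity b F -> has_parity b G -> has_parity b (F + G).
Proof.
move=> bF bG g s; rewrite serDE.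
have [->|/bF//] := eqVneq (F g s) 0; rewrite add0r; exact: bG.
Qed.

Lemma has_parityN b F : has_parity b F -> has_parity b (- F).
Proof. by move=> bF g s; rewrite serNE oppr_eq0; exact: bF. Qed.

Lemma in_LambdaD F G : in_Lambda F -> in_Lambda G -> in_Lambda (F + G).
Proof. by move=> LF LG a; rewrite serDE LF LG addr0. Qed.

Lemma in_LambdaN F : in_Lambda F -> in_Lambda (- F).
Proof. by move=> LF a; rewrite serNE LF oppr0. Qed.

Lemma lzero_zero F : lzero F -> zero F.
Proof.
by exists 0; rewrite ?subr0 // => g s; rewrite eqxx.
Qed.

Lemma zeroN F : zero F -> zero (- F).
Proof. by rewrite -sub0r; apply: zeroB; exact: zero0. Qed.

Lemma zeroZ c F : zero F -> zero (c *: F).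
Proof.
move=> [F0 vF [A [B FE]]]; exists (c *: F0).
  by move=> g s; rewrite serZE mulf_eq0 negb_or => /andP[_ /vF].
exists (fun i => c *: A i), (fun i => c *: B i) => g s.
rewrite -scalerBr serZE FE mulrDr !mulr_sumr; congr (_ + _).
  by apply: eq_bigr => i _; rewrite /rots !(serDE, serNE, serZE) /=; ring.
by apply: eq_bigr => i _; rewrite /swaps !(serDE, serNE, serZE) /=; ring.
Qed.

(** Rotations and exchanges preserve the order, so primitives can be truncated to a single order. *)
Lemma zero_homog_part n F : zero F ->
  zero (fun g s => if order g s == n then F g s else 0).
Proof.
move=> [F0 vF [A [B FE]]].
exists (fun g s => if order g s == n then F0 g s else 0).
  by move=> g s; case: ifP => [_ /vF//|_]; rewrite eqxx.
exists (fun i g s => if order g s == n then A i g s else 0).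
exists (fun i g s => if order g s == n then B i g s else 0) => g s.
have o_rot (i : 'I_(size s)) w : order g (set_nth [::] s i w) = order g s.
  by rewrite /Defs.order size_set_nth (maxn_idPr _).
have o_swap (i : 'I_(size s).-1) u v :
    order g (take i s ++ [:: u; v] ++ drop i.+2 s) = order g s.
  rewrite /Defs.order !size_cat size_drop size_takel /=.
    by have := ltn_ord i; lia.
  by have := ltn_ord i; lia.
rewrite !(serDE, serNE); have [os|os] := eqVneq (order g s) n.
  rewrite -[LHS]/((F - F0) g s) FE.
  by congr (_ + _); apply: eq_bigr => i _; rewrite !(serDE, serNE) /rots /swaps
    ?o_rot ?o_swap os eqxx.
rewrite subr0 !big1 ?addr0 // => i _; rewrite !(serDE, serNE) /rots /swaps;
  by rewrite ?o_rot ?o_swap (negPf os) mulr0 subr0.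
Qed.

Lemma Fil_weight_ge p F : weight_ge p.+1 F -> Fil p F.
Proof.
move=> pF; exists F => [|g s /pF]; first by rewrite subrr; exact: zero0.
by rewrite /weight /Defs.order; lia.
Qed.

Lemma Fil_zero p F : zero F -> Fil p F.
Proof. by exists 0; rewrite ?subr0 // => g s; rewrite eqxx. Qed.

Lemma FilB p F G : Fil p F -> Fil p G -> Fil p (F - G).
Proof.
move=> [F' zF pF] [G' zG pG]; exists (F' - G').
  by rewrite opprD addrACA -opprD; exact: zeroB.
by move=> g s /neq0B[/pF|/pG].
Qed.

Lemma FilN p F : Fil p F -> Fil p (- F).
Proof. by move=> pF; rewrite -sub0r; apply: FilB => //; exact/Fil_zero/zero0. Qed.

Lemma FilD p F G : Fil p F -> Fil p G -> Fil p (F + G).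
Proof. by move=> pF pG; rewrite -[G]opprK; apply/FilB/FilN. Qed.

(** If [F'] represents [F] and starts in order $n+1$, the order $n$ part of the null element
    [F - F'] is [F] itself. *)
Lemma Fil_homog n F : homog n F -> Fil n.+1 F -> zero F.
Proof.
move=> nF [F' /(@zero_homog_part n) zF pF'].
congr zero: zF; apply: serP => g s; have [os|os] := eqVneq (order g s) n.
  rewrite serDE serNE (_ : F' g s = 0) ?subr0 //.
  by apply: contraTeq (leqnn n) => /pF'; rewrite os ltnn.
by apply/esym/eqP; apply: contraNT os => /nF ->.
Qed.

End Filtration.
(** * Extensions and gauge equivalence *)

Section ExtensionTheory.

Variable S : odd_space.
Hypothesis pairC : forall x y : S, pair x y = pair y x.
Hypothesis pair_odd : forall x y : S, pair x y != 0 -> par x != par y.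

Variables (h : wser S) (y : ser S) (n : nat).
Hypothesis h_even : forall w, h w != 0 -> wpar w = false.
Hypothesis y_ge2 : weight_ge 2 y.

Implicit Types (a e xi : ser S).

Let x : ser S := embed h + y.

Definition curvature (z : ser S) := diff z + 2^-1 *: bracket z z.

Lemma zero_bracket_embedC a : zero (bracket (embed h) a - bracket a (embed h)).
Proof. exact/lzero_zero/bracket_embedC. Qed.

(** The remainder is $da+\frac12([z,a]+[a,z]+[a,a])-\frac12([h,a]-[a,h])$: the first terms have
    order at least $n+2$, the last vanishes by symmetry. *)
Lemma curvature_shift (z a : ser S) : weight_ge 2 z -> homog n.+1 a ->
  Fil n.+2 (curvature (embed h + z + a) - curvature (embed h + z)
            - bracket (embed h) a).
Proof.
move=> z_ge2 /weight_ge_homog a_ge.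
rewrite /curvature !diffD !(bracketDl, bracketDr).
set hh := bracket (embed h) _; set hz := bracket _ z.
set ha := bracket _ a; set zh := bracket z _; set ah := bracket a _.
suff : Fil n.+2 (diff a + 2^-1 *: (bracket z a + bracket a z + bracket a a)
    - 2^-1 *: (ha - ah)).
  congr Fil; apply: serP => g s.
  by rewrite !(serDE, serNE, serZE); field.
apply: FilB; last by apply/Fil_zero/zeroZ/zero_bracket_embedC.
apply: Fil_weight_ge; apply: weight_geD; first exact: weight_ge_diff.
apply: weight_geZ; apply: weight_geD; first apply: weight_geD.
- by apply: (weight_ge_leq (weight_ge_bracket z_ge2 a_ge)); lia.
- by apply: (weight_ge_leq (weight_ge_bracket a_ge z_ge2)); lia.
- by apply: (weight_ge_leq (weight_ge_bracket a_ge a_ge)); lia.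
Qed.

Lemma curvature_extension e a : homog n.+1 e -> homog n.+1 a ->
  Fil n.+2 (curvature (x + e)) ->
  Fil n.+2 (curvature (x + (a + e))) <-> zero (bracket (embed h) a).
Proof.
move=> e_hom a_hom xeMC.
have z_ge2 : weight_ge 2 (y + e).
  by apply: weight_geD => //; exact: weight_ge_leq (weight_ge_homog e_hom) _.
have := curvature_shift z_ge2 a_hom.
rewrite [embed h + (y + e)]addrA -/x -[x + e + a]addrA [e + a]addrC => D; split=> [xaeMC|ha0].
  apply: Fil_homog (homog_bracket_embed a_hom) _.
  by have := FilB (FilB xaeMC xeMC) D; rewrite subKr.
by have := FilD (FilD D (Fil_zero n.+2 ha0)) xeMC; rewrite !subrK.
Qed.

(** The coboundary condition on bare representatives, so that it applies to differences of
    extensions. *)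
Definition cohomologous_to_zero a := exists xi,
  [/\ in_Lambda xi, homog n.+1 xi, has_parity true xi
    & zero (a - bracket (embed h) xi)].

Lemma exact0 : cohomologous_to_zero 0.
Proof.
exists 0; split=> [//|g s|g s|]; rewrite ?eqxx //.
by rewrite bracket0r subrr; exact: zero0.
Qed.

Lemma exactB a e : cohomologous_to_zero a -> cohomologous_to_zero e ->
  cohomologous_to_zero (a - e).
Proof.
move=> [xi [? ? ? za]] [et [? ? ? ze]]; exists (xi - et); split.
- exact/in_LambdaD/in_LambdaN.
- exact/homogD/homogN.
- exact/has_parityD/has_parityN.
- by rewrite bracketBr opprD addrACA -opprD; exact: zeroB.
Qed.

(** The leading term of the gauge action: only $[\xi,h]$ has order $n+1$, and it equals $[h,\xi]$ in
    coinvariants. *)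
Lemma gauge_step xi e : homog n.+1 xi -> homog n.+1 e ->
  weight_ge n.+2 (diff xi + bracket xi (x + e)) /\
  Fil n.+2 (diff xi + bracket xi (x + e) - bracket (embed h) xi).
Proof.
move=> /weight_ge_homog xi_ge /weight_ge_homog e_ge.
have h_ge : weight_ge 1 (embed h) by move=> g s /embed_weight ->.
have ye_ge : weight_ge 2 (y + e).
  by apply: weight_geD => //; exact: weight_ge_leq e_ge _.
rewrite /x -[embed h + y + e]addrA bracketDr; split.
  apply: weight_geD; first exact: weight_ge_leq (weight_ge_diff xi_ge) _.
  apply: weight_geD.
    by apply: (weight_ge_leq (weight_ge_bracket xi_ge h_ge)); lia.
  by apply: (weight_ge_leq (weight_ge_bracket xi_ge ye_ge)); lia.
have : Fil n.+2 (diff xi + bracket xi (y + e)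
    - (bracket (embed h) xi - bracket xi (embed h))).
  apply: FilB; last exact/Fil_zero/zero_bracket_embedC.
  apply: Fil_weight_ge; apply: weight_geD; first exact: weight_ge_diff.
  by apply: (weight_ge_leq (weight_ge_bracket xi_ge ye_ge)); lia.
by congr Fil; apply: serP => g s; rewrite !(serDE, serNE); ring.
Qed.

Definition exp_term xi (w : ser S) k : ser S :=
  (k.+1`!%:R : rat)^-1 *: iter k (bracket xi) w.

Lemma weight_ge_exp_term xi w k : homog n.+1 xi -> weight_ge n.+2 w ->
  weight_ge (k + n.+2) (exp_term xi w k).
Proof.
move=> /weight_ge_homog xi_ge w_ge; apply: weight_geZ.
elim: k => //= k IHk.
by apply: (weight_ge_leq (weight_ge_bracket xi_ge IHk)); lia.
Qed.

Lemma gauge_limit xi e : homog n.+1 xi -> homog n.+1 e ->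
  exists z, exp_cvg xi (x + e) z.
Proof.
move=> xi_hom e_hom; have [w_ge _] := gauge_step xi_hom e_hom.
set w := diff xi + _ in w_ge.
(* The [k]-th term has weight at least $k+n+2$, so at [(g, s)] all terms with [k] at least
   [weight g s] vanish and the limit is a finite sum. *)
exists (fun g s => (x + e) g s + \sum_(k < weight g s) exp_term xi w k g s).
move=> p; exists p => N pN; apply: Fil_weight_ge => g s.
rewrite -/w !(serDE, serNE) ser_sumE.
rewrite -[X in _ - (_ + X)]/(\sum_(k < N) exp_term xi w k g s).
case: (ltnP p (weight g s)) => // le_p; rewrite (_ : _ - _ = 0) ?eqxx //.
rewrite opprD addrACA subrr add0r; apply/eqP; rewrite subr_eq0; apply/eqP.
rewrite (big_ord_widen N (fun k => exp_term xi w k g s)) ?(leq_trans le_p) //.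
rewrite big_mkcond; apply: eq_bigr => k _; case: ltnP => // le_k.
by apply/esym/eqP; apply: contraTT le_k => /(weight_ge_exp_term xi_hom w_ge); lia.
Qed.

Lemma gauge_limit_mod xi e z : homog n.+1 xi -> homog n.+1 e ->
  exp_cvg xi (x + e) z ->
  Fil n.+2 (z - (x + e + bracket (embed h) xi)).
Proof.
(* Taking [N0.+1] terms ensures that the term $k=0$ is present; all later ones lie in $F_{n+2}$. *)
move=> xi_hom e_hom /(_ n.+2)[N0 /(_ N0.+1 (leqnSn _))].
have [w_ge w_mod] := gauge_step xi_hom e_hom.
set w := diff xi + _ in w_ge w_mod *; rewrite big_ord_recl /= invr1 scale1r.
set r := \sum_(k < N0) _.
have r_Fil : Fil n.+2 r.
  apply/Fil_weight_ge/weight_ge_sum => k _.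
  apply: (weight_ge_leq (weight_ge_exp_term (k := bump 0 k) xi_hom w_ge)).
  by rewrite /bump; lia.
move=> /FilD/(_ (FilD w_mod r_Fil)).
by congr Fil; apply: serP => g s; rewrite !(serDE, serNE); ring.
Qed.

(** Equivalence through $\xi$ means $e+[h,\xi]=e'$ modulo $F_{n+2}$, hence exactly by homogeneity;
    $-\xi$ is then a primitive of $e-e'$. *)
Lemma equiv_extensionP e e' : homog n.+1 e -> homog n.+1 e' ->
  equiv_extension x n e e' <-> cohomologous_to_zero (e - e').
Proof.
move=> e_hom e'_hom; split=> [[xi [xiL xi_hom xi_odd [z z_lim z_e']]]|].
  exists (- xi); split; [exact: in_LambdaN|exact: homogN|exact: has_parityN|].
  apply: (@Fil_homog _ n.+1).
    apply: homogD; first exact/homogD/homogN.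
    by apply/homogN/homog_bracket_embed/homogN.
  have := FilB z_e' (gauge_limit_mod xi_hom e_hom z_lim).
  congr Fil; rewrite bracketNr; apply: serP => g s.
  by rewrite !(serDE, serNE); ring.
move=> [xi [xiL /homogN xi_hom xi_odd ze]]; exists (- xi).
split; [exact: in_LambdaN|by []|exact: has_parityN|].
have [z z_lim] := gauge_limit xi_hom e_hom; exists z => //.
have := FilD (gauge_limit_mod xi_hom e_hom z_lim) (Fil_zero n.+2 ze).
congr Fil; rewrite bracketNr; apply: serP => g s.
by rewrite !(serDE, serNE); ring.
Qed.

End ExtensionTheory.
(** * The action of cohomology *)

Section ExtensionAction.

Variable S : odd_space.
Hypothesis pairC : forall x y : S, pair x y = pair y x.
Hypothesis pair_odd : forall x y : S, pair x y != 0 -> par x != par y.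

Variables (h : wser S) (y : ser S) (n : nat).
Hypothesis h_even : forall w, h w != 0 -> wpar w = false.
Hypothesis y_ge2 : weight_ge 2 y.

Implicit Types (e : ser S) (a : cocycle h n.+1 false).

Let x : ser S := embed h + y.

Let coh := cohomologous_to_zero h n.

Lemma cocycleP a : [/\ in_Lambda (val a), homog n.+1 (val a),
  has_parity false (val a) & zero (bracket (embed h) (val a))].
Proof. by have /asboolP := valP a. Qed.

Lemma is_extensionD a e : is_extension x n e -> is_extension x n (val a + e).
Proof.
have [aL a_hom a_even a_cocycle] := cocycleP a.
move=> [eL e_hom e_even [[x0 x0_even x0P] xeMC]]; split.
- exact: in_LambdaD.
- exact: homogD.
- exact: has_parityD.
split; last by apply/(curvature_extension pairC pair_odd h_even y_ge2).
exists (x0 + val a); first exact: has_parityD.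
congr Fil: x0P; apply: serP => g s; rewrite !(serDE, serNE); ring.
Qed.

(** Classes are sets of extensions; since coboundaries are closed under subtraction, being
    cohomologous is an equivalence relation, and equality of classes reduces to it. *)
Lemma extension_class_eq e e' : is_extension x n e -> is_extension x n e' ->
  extension_class x n e = extension_class x n e' <-> coh (e - e').
Proof.
have equivP e1 e2 : is_extension x n e1 -> is_extension x n e2 ->
    equiv_extension x n e1 e2 <-> coh (e1 - e2).
  by move=> [_ hom1 _ _] [_ hom2 _ _]; exact: equiv_extensionP.
move=> He He'; split=> [ee'|ce].
  have : extension_class x n e' e'.
    split; first exact: He'.
    by apply: (proj2 (equivP _ _ He' He')); rewrite subrr; exact: exact0.
  by rewrite -ee' => -[_ /(equivP _ _ He He')].
apply/seteqP; split=> e2 [He2 /equivP ce2]; split=> //; apply/equivP => //.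
  by have := exactB (ce2 He He2) ce; rewrite opprB addrC addrA subrK.
have := exactB (ce2 He' He2) (exactB (exact0 h n) ce).
by rewrite sub0r opprK addrC addrA subrK.
Qed.

Lemma coboundaryP a : a \in @is_coboundary S h n.+1 false <-> coh (val a).
Proof. by split=> [/asboolP|?]; [|apply/asboolP]. Qed.

Lemma cohomology_class_eq a b :
  cohomology_class a = cohomology_class b <-> coh (val a - val b).
Proof.
rewrite -raddfB -coboundaryP /cohomology_class.
by rewrite Quotient.idealrBE; split=> [->|/eqP].
Qed.

Lemma cohomology_classK (c : cohomology h n.+1 false) :
  cohomology_class (repr c) = c.
Proof. exact: reprK. Qed.

Lemma extension_rep (E : Ext x n) :
  {e | is_extension x n e & extension_class x n e = \val E}.
Proof. by apply: cid2; have := set_mem (valP E). Qed.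

(** The sum is formed on chosen representatives of both classes; [translateE] shows that the choice
    does not matter. *)
Definition translate (c : cohomology h n.+1 false) (E : Ext x n) : Ext x n :=
  let: exist2 e e_ext _ := extension_rep E in
  SigSub (mem_set (imageP (extension_class x n) (is_extensionD (repr c) e_ext))).

Lemma translateE a e E : is_extension x n e -> \val E = extension_class x n e ->
  \val (translate (cohomology_class a) E) = extension_class x n (val a + e).
Proof.
move=> e_ext Ee; rewrite /translate.
case: (extension_rep E) => e' e'_ext /=; rewrite Ee => /extension_class_eq ee'.
apply/extension_class_eq; try exact: is_extensionD.
have /cohomology_class_eq ra := cohomology_classK (cohomology_class a).
have := exactB ra (exactB (exact0 h n) (ee' e'_ext e_ext)).
by rewrite sub0r opprK opprD addrACA.
Qed.

Lemma ExtP (E : Ext x n) :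
  exists2 e, is_extension x n e & \val E = extension_class x n e.
Proof. by have [e ? ?] := extension_rep E; exists e. Qed.

Lemma translate_action : is_action translate.
Proof.
split=> [E|c c' E]; have [e e_ext Ee] := ExtP E; apply: val_inj.
  have <- : cohomology_class 0 = 0 :> cohomology h n.+1 false by exact: raddf0.
  by rewrite (translateE _ e_ext Ee) raddf0 add0r.
rewrite -(cohomology_classK c) -(cohomology_classK c').
set a := repr c; set a' := repr c'.
have <- : cohomology_class (a + a') = cohomology_class a + cohomology_class a'.
  exact: raddfD.
have E' := translateE a' e_ext Ee.
rewrite (translateE _ (is_extensionD a' e_ext) E') (translateE _ e_ext Ee).
by rewrite raddfD addrA.
Qed.

Lemma translate_free : acts_freely translate.
Proof.
move=> c E cE; have [e e_ext Ee] := ExtP E.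
rewrite -(cohomology_classK c) in cE *; set a := repr c in cE *.
have /extension_class_eq : extension_class x n (val a + e) = extension_class x n e.
  by rewrite -Ee -[in RHS]cE (translateE _ e_ext Ee).
rewrite addrK => /(_ (is_extensionD a e_ext) e_ext) a_exact.
have <- : cohomology_class 0 = 0 :> cohomology h n.+1 false by exact: raddf0.
by apply/cohomology_class_eq; rewrite raddf0 subr0.
Qed.

(** The difference of two extensions is a cocycle, and its class carries one to the other. *)
Lemma translate_transitive : acts_transitively translate.
Proof.
move=> E E'; have [e e_ext Ee] := ExtP E; have [e' e'_ext Ee'] := ExtP E'.
have [eL e_hom e_even [_ eMC]] := e_ext.
have [e'L e'_hom e'_even [_ e'MC]] := e'_ext.
have a_hom : homog n.+1 (e' - e) by exact/homogD/homogN.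
have a_cocycle : e' - e \in is_cocycle h n.+1 false.
  apply/asboolP; split=> //; first exact/in_LambdaD/in_LambdaN.
    exact/has_parityD/has_parityN.
  apply/(curvature_extension pairC pair_odd h_even y_ge2 e_hom a_hom eMC).
  by rewrite subrK.
exists (cohomology_class (Cocycle a_cocycle)); apply: val_inj.
by rewrite (translateE _ e_ext Ee) Ee' /= subrK.
Qed.

End ExtensionAction.

Theorem theorem5p2 (W : vectType rat) (W0 W1 : {vspace W})
    (form : {symmetric W})
    (Wgraded : is_graded W0 W1) (form_odd : odd_form W0 W1 form)
    (form_nondeg : nondegenerate form)
    (h : wser (PiDual W0 W1 form)) (hMC : MC_h2 h)
    (n : nat) (hs : nat -> ser (PiDual W0 W1 form))
    (hs0 : hs 0%N = embed h)
    (hsL : forall i, (i <= n)%N -> in_Lambda (hs i) /\ homog i (hs i))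
    (xMC : MC_mod n.+1 (\sum_(i < n.+1) hs i)) :
  let x := \sum_(i < n.+1) hs i in
  exists act : cohomology h n.+1 false -> Ext x n -> Ext x n,
    [/\ forall (a : cocycle h n.+1 false) (e : ser (PiDual W0 W1 form))
          (E : Ext x n),
          is_extension x n e -> \val E = extension_class x n e ->
          is_extension x n (\val a + e) /\
          \val (act (cohomology_class a) E) = extension_class x n (\val a + e),
        is_action act, acts_freely act & acts_transitively act].
Proof.
have [_ h_even _] := hMC.
(* The part of positive order, that is, of weight at least 2. *)
pose y := \sum_(i < n) hs i.+1.
have y_ge2 : weight_ge 2 y.
  apply: weight_ge_sum => i _; have [|_ /weight_ge_homog hs_ge] := hsL i.+1 _.
    exact: ltn_ord.
  exact: weight_ge_leq hs_ge _.
have -> : \sum_(i < n.+1) hs i = embed h + y by rewrite big_ord_recl hs0.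
have pairC := @PiDual_pairC W W0 W1 form form_odd.
have pair_odd := @PiDual_pair_odd W W0 W1 form form_odd.
exists (translate pairC pair_odd h_even y_ge2); split.
- move=> a e E e_ext Ee; split; first exact: is_extensionD.
  exact: translateE.
- exact: translate_action.
- exact: translate_free.
- exact: translate_transitive.
Qed.
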